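(* For each $n\ge1$ and each choice of sign $\pm$, let $W_n^{\pm}$ be a random variable with $\mathbb{P}(W_n^{\pm}=k)=\langle n,k\rangle^{\pm}/|S_n^{\pm}|$ for $k=1,\dots,n$ (equivalently, $W_n^\pm$ is $\mathrm{des}(w)+1$ for $w$ uniform in $S_n^\pm$). Then, as $n\to\infty$, the distribution of $W_n^{\pm}$ is asymptotically normal, i.e. $(W_n^{\pm}-\mathbb{E}W_n^\pm)/\sqrt{\mathrm{Var}(W_n^\pm)}$ converges in distribution to a standard normal. Moreover, for $n\ge 4$ the mean of $W_n^{\pm}$ is $(n+1)/2$, and for $n\ge 6$ its variance is $(n+1)/12$.
   Context: For $w\in S_n$ (permutations of $[n]$ in one-line notation), $\mathrm{des}(w)=|\{1\le i\le n-1: w(i)>w(i+1)\}|$ and $\mathrm{sgn}(w)$ is the sign of $w$. $S_n^{+}$ (resp. $S_n^-$) is the set of permutations with sign $1$ (resp. $-1$). The positive/negative Eulerian numbers are $\langle n,k\rangle^{\pm}=|\{w\in S_n^{\pm}:\mathrm{des}(w)=k-1\}|$, i.e. the coefficients of $t^k$ in $A_n^\pm(t)=\sum_{w\in S_n^\pm}t^{\mathrm{des}(w)+1}$. *)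

(* Defs.v *)
From HB Require Import structures.
From mathcomp Require Export all_boot all_order all_algebra all_fingroup.
From mathcomp Require Export all_classical all_reals all_analysis.
From mathcomp Require Export measurable_realfun.
Export numFieldNormedType.Exports.

Set Implicit Arguments.
Unset Strict Implicit.
Unset Printing Implicit Defensive.

Import Order.TTheory GRing.Theory Num.Theory.

Local Open Scope classical_set_scope.
Local Open Scope ring_scope.

(* Permutations act on {0, ..., n-1} rather than on {1, ..., n}.  The
   witness j = i + 1 forces i to range over the first n - 1 positions. *)
Definition des (n : nat) (w : 'S_n) : nat :=
  #|[set i : 'I_n |
      [exists j : 'I_n, (j == i.+1 :> nat) && (w j < w i)%N]]%SET|.

(* The sign (-1) ^+ s is encoded by the boolean s: false stands for + and
   true for -, so that sgn w = (-1) ^+ s iff odd_perm w = s. *)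
Definition signed_perms (n : nat) (s : bool) : {set 'S_n} :=
  [set w : 'S_n | odd_perm w == s]%SET.

Definition signed_eulerian (n : nat) (s : bool) (k : nat) : nat :=
  #|[set w in signed_perms n s | (des w).+1 == k]%SET|.

Section Standardization.
Context d (T : measurableType d) (R : realType) (P : probability T R).

Definition standardize_fun (X : {RV P >-> R}) : T -> R :=
  fun x => (X x - fine 'E_P[X]) / Num.sqrt (fine 'V_P[X]).

Lemma measurable_standardize (X : {RV P >-> R}) :
  measurable_fun setT (standardize_fun X).
Proof.
apply: measurable_funM; last exact: measurable_cst.
by apply: measurable_funB; [exact: measurable_funPT | exact: measurable_cst].
Qed.

HB.instance Definition _ (X : {RV P >-> R}) :=
  isMeasurableFun.Build _ _ _ _ (standardize_fun X) (measurable_standardize X).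

Definition standardize (X : {RV P >-> R}) : {RV P >-> R} := standardize_fun X.

End Standardization.

(* The variables X n may live on different probability spaces. *)
Definition cvg_in_distribution (R : realType) (d : nat -> measure_display)
    (T : forall n, measurableType (d n)) (P : forall n, probability (T n) R)
    (X : forall n, {RV (P n) >-> R}) (mu : probability (measurableTypeR R) R) : Prop :=
  forall x : R, {for x, continuous (fun y : R => mu `]-oo, y]%classic)} ->
    cdf (X n) x @[n --> \oo] --> mu `]-oo, x]%classic.

(* Main.v *)
(* Stein's method.  Write des w + 1 = (n + 1) / 2 + S with S the sum of the
   variables x_i = +1/2 or -1/2 recording whether w has a descent between two
   consecutive positions.  Transposing these positions changes the sign of x_i
   and only affects its two neighbours, so over the full symmetric group x_i is
   orthogonal to every function of S - (x_(i-1) + x_i + x_(i+1)); a Taylor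
   expansion then bounds E[f' Z - Z f Z] by O(1 / sigma) for Z = S / sigma, the
   products x_i x_(i+1) being uncorrelated at distance at least 3 (rotate three
   consecutive positions).  For suitable f, f' z - z f z dominates, or is
   dominated by, the centred indicator of a half-line, which gives the central
   limit theorem over the symmetric group.
   To pass to permutations of a given sign, exchange the values 0 and 1: unless
   they are adjacent in w, which has probability at most 2 / (n - 1), this keeps
   the descent set and reverses the sign.  The mean and the variance are exact
   because a product of two of the x_i involves at most four positions, and two
   further positions can be transposed. *)
From HB Require Import structures.
Require Import Defs.
From mathcomp Require Import ring lra zify.

Set Implicit Arguments.
Unset Strict Implicit.
Unset Printing Implicit Defensive.

Import Order.TTheory GRing.Theory Num.Theory.

Local Open Scope classical_set_scope.
Local Open Scope ring_scope.

(** * Calculus and the normal distribution function *)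

Section Calculus.
Context {R : realType}.
Implicit Types (f g : R -> R) (x y z : R).

Lemma is_derive_continuous f (df : R -> R) : (forall z, is_derive z (1 : R) f (df z)) ->
  continuous f.
Proof.
by move=> h z; apply/differentiable_continuous/derivable1_diffP; have [] := h z.
Qed.

Lemma is_derive_MVT f (df : R -> R) : (forall z, is_derive z (1 : R) f (df z)) ->
  forall x y, exists2 c, (x <= c <= y) || (y <= c <= x) &
    f y - f x = df c * (y - x).
Proof.
move=> h; have cf := is_derive_continuous h.
have key x y : x <= y -> exists2 c, (x <= c <= y) & f y - f x = df c * (y - x).
  move=> xy; have [|c] := @MVT_segment _ f df x y xy.
    exact: continuous_subspaceT.
  by rewrite in_itv /= => hc e; exists c.
move=> x y; have [xy|/ltW yx] := leP x y.
  by have [c hc e] := key _ _ xy; exists c; rewrite ?hc.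
have [c hc e] := key _ _ yx; exists c; first by rewrite hc orbT.
by rewrite -opprB e -mulrN opprB.
Qed.

Lemma ge0_is_derive_homo f (df : R -> R) u : (forall z, is_derive z (1 : R) f (df z)) ->
  (forall z, z <= u -> 0 <= df z) -> forall x y, x <= y -> y <= u -> f x <= f y.
Proof.
move=> h df0 x y xy yu; have [c hc e] := is_derive_MVT h x y.
rewrite -subr_ge0 e mulr_ge0 ?subr_ge0 // df0 //.
by case/orP: hc => /andP[h1 h2]; lra.
Qed.

(** Such an [f] is nondecreasing up to [u], so its values dominate its limit at minus infinity. The
    Mills inequalities below are all proved this way. *)
Lemma ge0_of_derive_cvgNy f (df : R -> R) u :
  (forall z, is_derive z (1 : R) f (df z)) ->
  (forall z, z <= u -> 0 <= df z) -> f x @[x --> -oo] --> (0 : R) ->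
  forall z, z <= u -> 0 <= f z.
Proof.
move=> h df0 f0 z zu.
have fle : \forall x \near -oo, f x <= f z.
  apply: filterS (nbhs_ninfty_le (num_real z)) => x xz.
  exact: (ge0_is_derive_homo h df0).
exact: (cvgr_to_le f0 fle).
Qed.

(** Made for the truncated square [sqp]: the quadratic estimate is uniform, so its knot needs no
    one-sided limits. *)
Lemma is_derive_of_quadratic f z (df C : R) :
  (forall h, `|f (z + h) - f z - h * df| <= C * h ^+ 2) ->
  is_derive z (1 : R) f df.
Proof.
move=> H.
have H' : h^-1 *: (f (h + z) - f z) @[h --> (0 : R)^'] --> df.
  apply/cvgrPdist_le => e e0; near=> h.
  have h0 : h != 0 by near: h; exact: nbhs_dnbhs_neq.
  have -> : df - h^-1 *: (f (h + z) - f z) = - (h^-1 * (f (z + h) - f z - h * df)).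
    rewrite /GRing.scale /= [h + z]addrC; by field.
  rewrite normrN normrM normfV.
  have hp : 0 < `|h| by rewrite normr_gt0.
  rewrite mulrC ler_pdivrMr // (le_trans (H h)) //.
  rewrite -real_normK ?num_real // expr2 mulrA ler_pM2r //.
  have : `|C| * `|h| <= e.
    have Cp : 0 < `|C| + 1 by rewrite ltr_wpDl.
    have : `|h| <= e / (`|C| + 1).
      by near: h; apply: dnbhs0_le; rewrite divr_gt0.
    rewrite ler_pdivlMr // => h1; have := normr_ge0 h; nra.
  by apply: le_trans; apply: ler_wpM2r; rewrite ?ler_norm.
apply: DeriveDef.
  apply/cvg_ex; exists df.
  have -> : (fun h : R => h^-1 *: ((f \o shift z) (h *: (1 : R)) - f z)) =
     (fun h => h^-1 *: (f (h + z) - f z)).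
    by apply/funext => h /=; rewrite /shift /= /GRing.scale /= mulr1.
  exact: H'.
apply/cvg_lim => //.
have -> : (fun h : R => h^-1 *: ((f \o shift z) (h *: (1 : R)) - f z)) =
     (fun h => h^-1 *: (f (h + z) - f z)).
    by apply/funext => h /=; rewrite /shift /= /GRing.scale /= mulr1.
exact: H'.
Unshelve. all: by end_near. Qed.

Lemma continuous_bounded_segment f x y : continuous f ->
  exists C, forall z, x <= z <= y -> `|f z| <= C.
Proof.
move=> cf; have [xy|yx] := leP x y; last first.
  by exists 0 => z /andP[h1 h2]; lra.
have cn : {within `[x, y], continuous (fun z => `|f z|)}.
  apply: continuous_subspaceT => z.
  by apply: (@continuous_comp _ _ _ f Num.norm); [exact: cf | exact: norm_continuous].
have [c _ hc] := EVT_max xy cn.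
by exists `|f c| => z hz; apply: hc; rewrite in_itv.
Qed.

Lemma continuous_bounded f x y Cx Cy : continuous f ->
  (forall z, z <= x -> `|f z| <= Cx) -> (forall z, y <= z -> `|f z| <= Cy) ->
  exists C, forall z, `|f z| <= C.
Proof.
move=> cf hx hy; have [C hC] := continuous_bounded_segment x y cf.
have nn (t : R) : t <= `|t| := ler_norm t.
have nC := nn C; have nx := nn Cx; have ny := nn Cy.
exists (`|Cx| + `|Cy| + `|C|) => z.
have pC := normr_ge0 C; have px := normr_ge0 Cx; have py := normr_ge0 Cy.
have [zx|/ltW zx] := leP z x; first by have := hx _ zx; lra.
have [zy|/ltW zy] := leP y z; first by have := hy _ zy; lra.
have := hC z; rewrite zx zy => /(_ isT); lra.
Qed.

End Calculus.

(** * The standard normal density and distribution function *)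

Section Normal.
Context {R : realType}.
Implicit Types (x y z : R).

Definition normal_density z : R := normal_pdf 0 1 z.
Definition normal_cdf z : R := fine (normal_prob (0 : R) 1 `]-oo, z]%classic).
Local Notation phi := normal_density.
Local Notation Phi := normal_cdf.

Lemma normal_densityE z : phi z = normal_peak 1 * expR (- (z ^+ 2 / 2)).
Proof.
rewrite /normal_density normal_pdfE ?oner_eq0 // /normal_fun.
by rewrite subr0 expr1n mulNr.
Qed.

Lemma normal_density_gt0 z : 0 < phi z.
Proof. by rewrite normal_densityE mulr_gt0 ?expR_gt0 ?normal_peak_gt0 ?oner_eq0. Qed.

Lemma normal_density_neq0 z : phi z != 0.
Proof. by rewrite gt_eqF ?normal_density_gt0. Qed.

Lemma normal_densityN z : phi (- z) = phi z.
Proof. by rewrite !normal_densityE sqrrN. Qed.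

Lemma is_derive_expR_sqr (c z : R) :
  is_derive z (1 : R) (fun t => expR (c * (t * t))) (2 * c * z * expR (c * (z * z))).
Proof.
have h : is_derive z (1 : R) (fun t : R => c * (t * t)) (2 * c * z).
  by apply: is_derive_eq; rewrite /GRing.scale /=; ring.
have := @is_derive1_comp _ expR (fun t : R => c * (t * t)) z _ _
  (is_derive_expR _) h.
by rewrite /comp mulrC.
Qed.

Lemma is_derive_normal_density z : is_derive z (1 : R) phi (- z * phi z).
Proof.
have -> : phi = (fun t => normal_peak 1 * expR (- 2^-1 * (t * t))).
  by apply/funext => t; rewrite normal_densityE; congr (_ * expR _); field.
have h := is_derive_expR_sqr (- 2^-1) z.
by apply: is_derive_eq; rewrite /GRing.scale /=; field.
Qed.

Lemma is_derive_inv_normal_density z :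
  is_derive z (1 : R) (fun t => (phi t)^-1) (z / phi z).
Proof.
have -> : (fun t : R => (phi t)^-1) =
    (fun t => (normal_peak 1)^-1 * expR (2^-1 * (t * t))).
  apply/funext => t; rewrite normal_densityE invfM -expRN opprK.
  by congr (_ * expR _); field.
rewrite normal_densityE invfM -expRN opprK.
have h := is_derive_expR_sqr 2^-1 z.
apply: is_derive_eq; rewrite /GRing.scale /=.
rewrite (_ : 2^-1 * (z * z) = z ^+ 2 / 2); last by field.
by rewrite mulrCA [2 * _]mulrC mulVf ?pnatr_eq0 // mul1r.
Qed.

Lemma is_derive_normal_cdf z : is_derive z (1 : R) Phi (phi z).
Proof.
have z1 : z < z + 1 by rewrite ltrDl.
have iphi : lebesgue_measure.-integrable `]-oo, z + 1]%classic (EFin \o phi).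
  by apply: (integrableS _ _ (@subsetT _ _)) => //; exact: integrable_normal_pdf.
have cphi := @continuous_normal_pdf R 0 1 (oner_neq0 _) z.
have [|h1 h2] := continuous_FTC1 z1 iphi _ cphi; first by rewrite ltNyr.
by apply: DeriveDef; [exact: h1 | rewrite -derive1E; exact: h2].
Qed.

Lemma continuous_normal_cdf : continuous Phi.
Proof. exact: is_derive_continuous is_derive_normal_cdf. Qed.

End Normal.

Section NormalLimits.
Context {R : realType}.

Local Notation phi := (@normal_density R).
Local Notation Phi := (@normal_cdf R).

Let idTR : measurableTypeR R -> R := idfun.

#[local] HB.instance Definition _ :=
  @isMeasurableFun.Build _ _ _ _ idTR (@measurable_id _ _ setT).

Let normal_cdf_cdf :
  Phi = fine \o cdf (idTR : {RV (normal_prob (0 : R) 1) >-> R}).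
Proof. by []. Qed.

Lemma normal_cdf_ge0 z : 0 <= Phi z.
Proof. by rewrite fine_ge0. Qed.

Lemma normal_prob_NyE z : normal_prob (0 : R) 1 `]-oo, z]%classic = (Phi z)%:E.
Proof. by rewrite fineK // fin_num_measure. Qed.

Lemma cvg_normal_cdfNy : Phi z @[z --> -oo] --> (0 : R).
Proof. by rewrite normal_cdf_cdf; exact/fine_cvg/cvg_cdfNy0. Qed.

Lemma cvg_normal_cdfy : Phi z @[z --> +oo] --> (1 : R).
Proof. by rewrite normal_cdf_cdf; exact/fine_cvg/cvg_cdfy1. Qed.

End NormalLimits.

#[global] Hint Resolve normal_density_gt0 normal_cdf_ge0 : core.

(** * Mills ratio inequalities *)

Section Mills.
Context {R : realType}.
Implicit Types (x y z : R).

Local Notation phi := (@normal_density R).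
Local Notation Phi := (@normal_cdf R).

#[local] Existing Instance is_derive_normal_density.
#[local] Existing Instance is_derive_normal_cdf.
#[local] Existing Instance is_derive_inv_normal_density.

Lemma is_derive_normal_cdfN z :
  is_derive z (1 : R) (fun t => Phi (- t)) (- phi z).
Proof.
have h : is_derive z (1 : R) (fun t : R => - t) (- 1).
  exact: is_deriveNid.
have h1 := is_derive_normal_cdf (- z).
have := @is_derive1_comp _ Phi (fun t : R => - t) z _ _ h1 h.
by rewrite /comp mulrN1 normal_densityN.
Qed.

(** [Phi t + Phi (- t)] has zero derivative, and its limit at minus infinity is 0 + 1. *)
Lemma normal_cdfN z : Phi (- z) = 1 - Phi z.
Proof.
have dD x : is_derive x (1 : R) (fun t => Phi t + Phi (- t)) 0.
  have h := is_derive_normal_cdfN x.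
  by apply: is_derive_eq; rewrite subrr.
have cst x : Phi x + Phi (- x) = Phi z + Phi (- z).
  have [c _ /eqP] := is_derive_MVT dD z x.
  by rewrite mul0r subr_eq0 => /eqP.
have l1 : Phi x + Phi (- x) @[x --> -oo] --> (0 + 1 : R).
  apply: (@cvgD _ R^o); first exact: cvg_normal_cdfNy.
  rewrite cvgNy_compNP (_ : (fun x => _) \o _ = Phi).
    exact: cvg_normal_cdfy.
  by apply/funext => x /=; rewrite opprK.
have l2 : Phi x + Phi (- x) @[x --> -oo] --> Phi z + Phi (- z).
  by under eq_fun do rewrite cst; exact: cvg_cst.
have e : 0 + 1 = Phi z + Phi (- z) := cvg_unique (@Rhausdorff R) l1 l2.
by rewrite -[1]add0r e addrAC subrr add0r.
Qed.

Lemma normal_cdf_homo x y : x <= y -> Phi x <= Phi y.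
Proof.
move=> xy; apply: (@ge0_is_derive_homo _ _ phi y) => //.
by move=> z _; exact: ltW.
Qed.

Lemma cvg_idM_normal_densityNy : z * phi z @[z --> -oo] --> (0 : R).
Proof.
apply/cvgrPdist_le => e e0; near=> z.
have p0 : 0 < normal_peak 1 :> R by rewrite normal_peak_gt0 ?oner_eq0.
rewrite sub0r normrN normal_densityE expRN mulrA normrM normfV.
rewrite [X in _ / X]gtr0_norm ?expR_gt0 // ler_pdivrMr ?expR_gt0 //.
have E1 := expR_ge1Dx (z ^+ 2 / 2).
(* As [expR (z ^+ 2 / 2)] is at least [z ^+ 2 / 2], it suffices that
   [2 * normal_peak 1 <= e * - z]. *)
have hz : z <= - (2 * normal_peak 1 / e) - 1.
  by near: z; apply: nbhs_ninfty_le; rewrite num_real.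
have h0 : 0 < 2 * normal_peak 1 / e by rewrite divr_gt0 ?mulr_gt0.
have h1 : 2 * normal_peak 1 <= e * - z.
  rewrite -(divfK (lt0r_neq0 e0) (2 * _)) mulrC ler_pM2l //; lra.
have z0 : z < 0 by lra.
rewrite normrM (ltr0_norm z0) (gtr0_norm p0).
have h2 : e * (z ^+ 2 / 2) <= e * expR (z ^+ 2 / 2) by rewrite ler_pM2l //; lra.
have h3 : 2 * normal_peak 1 * - z <= e * - z * - z by rewrite ler_wpM2r //; lra.
lra.
Unshelve. all: by end_near. Qed.

Lemma cvg_normal_densityNy : phi z @[z --> -oo] --> (0 : R).
Proof.
have h : - (z * phi z) @[z --> -oo] --> (- 0 : R).
  by apply: (@cvgN _ R^o); exact: cvg_idM_normal_densityNy.
rewrite oppr0 in h.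
have le_phi : \forall z \near -oo, 0 <= phi z <= - (z * phi z).
  apply: filterS (nbhs_ninfty_le (num_real (- 1))) => z z1; rewrite ltW //=.
  by have := normal_density_gt0 z; nra.
exact: (squeeze_cvgr le_phi (cvg_cst (0 : R)) h).
Qed.

(** For fixed [z], the function sending [x] to [phi x + z * Phi x] has derivative [(z - x) * phi x],
    nonnegative up to [z], and tends to 0 at minus infinity. *)
Lemma mills_upper z : 0 <= z * Phi z + phi z.
Proof.
have dK x : is_derive x (1 : R) (fun t => phi t + z * Phi t)
    (- x * phi x + z * phi x).
  by apply: is_derive_eq; rewrite /GRing.scale /=; ring.
have dK0 x : x <= z -> 0 <= - x * phi x + z * phi x.
  by move=> xz; have := normal_density_gt0 x; nra.
rewrite addrC; apply: (ge0_of_derive_cvgNy dK dK0) => //.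
rewrite -[X in _ --> X](_ : 0 + z * 0 = 0); last by ring.
apply: (@cvgD _ R^o); first exact: cvg_normal_densityNy.
by apply: (@cvgM _ R^o); [exact: cvg_cst | exact: cvg_normal_cdfNy].
Qed.

(** [G / phi] is the second derivative of the ratio [Phi / phi]. *)
Let G z := (1 + z * z) * Phi z + z * phi z.

Let is_derive_G z : is_derive z (1 : R) G (2 * (z * Phi z + phi z)).
Proof. by apply: is_derive_eq; rewrite /GRing.scale /=; ring. Qed.

Let cvg_G : G z @[z --> -oo] --> (0 : R).
Proof.
have h2 : z * z * Phi z @[z --> -oo] --> (0 : R).
  have h : - (z * phi z) @[z --> -oo] --> (- 0 : R).
    by apply: (@cvgN _ R^o); exact: cvg_idM_normal_densityNy.
  rewrite oppr0 in h.
  (* The upper bound is [mills_upper] multiplied by the negative number [z]. *)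
  have le_G : \forall z \near -oo, 0 <= z * z * Phi z <= - (z * phi z).
    apply: filterS (nbhs_ninfty_le (num_real (- 1))) => z z1.
    have zz : 0 <= z * z by rewrite -expr2 sqr_ge0.
    rewrite (mulr_ge0 zz (normal_cdf_ge0 z)) /=.
    by have := mills_upper z; nra.
  exact: (squeeze_cvgr le_G (cvg_cst (0 : R)) h).
rewrite (_ : G = fun z => Phi z + z * z * Phi z + z * phi z).
  rewrite -[X in _ --> X](_ : 0 + 0 + 0 = 0); last by ring.
  apply: (@cvgD _ R^o); last exact: cvg_idM_normal_densityNy.
  by apply: (@cvgD _ R^o) => //; exact: cvg_normal_cdfNy.
by apply/funext => z; rewrite /G; ring.
Qed.

Lemma mills_lower z : 0 <= (1 + z * z) * Phi z + z * phi z.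
Proof.
apply: (ge0_of_derive_cvgNy is_derive_G _ cvg_G (lexx z)) => x _.
by rewrite mulr_ge0 ?mills_upper.
Qed.

(** The derivative of [2 * phi - G] at [x] is [- 2 * (x + 1) * phi x - 2 * x * Phi x], nonnegative
    for [x <= - 1]. *)
Lemma mills_second z : z <= - 1 -> (1 + z * z) * Phi z + z * phi z <= 2 * phi z.
Proof.
move=> z1; rewrite -subr_ge0.
have dK x : is_derive x (1 : R) (fun t => 2 * phi t - G t)
    (2 * (- x * phi x) - 2 * (x * Phi x + phi x)).
  have h := is_derive_G x.
  by apply: is_derive_eq; rewrite /GRing.scale /=; ring.
apply: (ge0_of_derive_cvgNy dK _ _ z1) => [x x1|].
  by have := normal_cdf_ge0 x; have := normal_density_gt0 x; nra.
rewrite -[X in _ --> X](_ : 2 * 0 - 0 = 0); last by ring.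
apply: (@cvgB _ R^o); last exact: cvg_G.
by apply: (@cvgM _ R^o); [exact: cvg_cst | exact: cvg_normal_densityNy].
Qed.

(** The Mills ratio of the lower tail; it solves [g' - z g = 1], the Stein equation with constant
    right-hand side. *)
Definition mills z := Phi z / phi z.

Lemma is_derive_mills z : is_derive z (1 : R) mills (1 + z * mills z).
Proof.
apply: is_derive_eq; rewrite /GRing.scale /= /mills.
by field; rewrite normal_density_neq0.
Qed.

(** The two quantities are the first and second derivatives of [mills]. *)
Lemma mills_bounds z : z <= - 1 ->
  `|1 + z * mills z| <= 1 /\ `|mills z + z * (1 + z * mills z)| <= 2.
Proof.
move=> z1; have p := normal_density_gt0 z.
have e1 : 1 + z * mills z = (z * Phi z + phi z) / phi z.
  by rewrite /mills; field; rewrite normal_density_neq0.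
have e2 : mills z + z * (1 + z * mills z) =
    ((1 + z * z) * Phi z + z * phi z) / phi z.
  by rewrite /mills; field; rewrite normal_density_neq0.
have h1 := mills_upper z; have h2 := mills_lower z.
have h3 := mills_second z1; have h4 := normal_cdf_ge0 z.
rewrite e2 e1 !ger0_norm ?ler_pdivrMr ?divr_ge0 ?(ltW p) //.
by split => //; nra.
Qed.

End Mills.

(** * Test functions for the Stein equation *)

Section SmoothStep.
Context {R : realType}.
Implicit Types (x y z : R).

Lemma is_derive_affine (f : R -> R) (df c a z : R) :
  is_derive (c * (z - a)) (1 : R) f df ->
  is_derive z (1 : R) (fun t => f (c * (t - a))) (c * df).
Proof.
move=> h.
have h1 : is_derive z (1 : R) (fun t : R => c * (t - a)) c.
  by apply: is_derive_eq; rewrite /GRing.scale /=; ring.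
by have := @is_derive1_comp _ f (fun t : R => c * (t - a)) z _ _ h h1; rewrite mulrC.
Qed.

Let pos z : R := Num.max z 0.

Let posP z : (z <= 0 /\ pos z = 0) \/ (0 <= z /\ pos z = z).
Proof. by rewrite /pos; case: (leP z 0) => h; [left|right; rewrite ltW]. Qed.

Let sqp z : R := pos z * pos z.
(** The truncated cube, written with a factor [z] so that the product rule reduces it to [sqp]. *)
Let cubp z : R := z * sqp z.

Let is_derive_sqp z : is_derive z (1 : R) sqp (2 * pos z).
Proof.
apply: (@is_derive_of_quadratic _ _ _ _ 1) => h; rewrite mul1r /sqp ler_norml.
by case: (posP z) => -[? ->]; case: (posP (z + h)) => -[? ->]; apply/andP; split; nra.
Qed.

Let is_derive_cubp z : is_derive z (1 : R) cubp (3 * sqp z).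
Proof.
have h := is_derive_sqp z.
apply: is_derive_eq; rewrite /GRing.scale /= /sqp.
by case: (posP z) => -[_ ->]; ring.
Qed.

Let is_derive_shift_sub (f : R -> R) (df k z : R) : is_derive (z - k) (1 : R) f df ->
  is_derive z (1 : R) (fun t => f (t - k)) df.
Proof.
move=> h; have := @is_derive_affine f df 1 k z; rewrite !mul1r => /(_ h).
by under eq_fun do rewrite mul1r.
Qed.

(* The integral of the cardinal quadratic B-spline. *)
Let step z : R :=
  6^-1 * (cubp z - 3 * cubp (z - 1) + 3 * cubp (z - 2) - cubp (z - 3)).
Let step1 z : R :=
  2^-1 * (sqp z - 3 * sqp (z - 1) + 3 * sqp (z - 2) - sqp (z - 3)).
Let step2 z : R := pos z - 3 * pos (z - 1) + 3 * pos (z - 2) - pos (z - 3).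

Let is_derive_step z : is_derive z (1 : R) step (step1 z).
Proof.
have h0 := is_derive_cubp z.
have h k := is_derive_shift_sub (is_derive_cubp (z - k)).
have h1 := h 1; have h2 := h 2; have h3 := h 3.
by apply: is_derive_eq; rewrite /GRing.scale /= /step1; field.
Qed.

Let is_derive_step1 z : is_derive z (1 : R) step1 (step2 z).
Proof.
have h0 := is_derive_sqp z.
have h k := is_derive_shift_sub (is_derive_sqp (z - k)).
have h1 := h 1; have h2 := h 2; have h3 := h 3.
by apply: is_derive_eq; rewrite /GRing.scale /= /step2; field.
Qed.

Let continuous_pos : continuous pos.
Proof.
move=> z; apply: (@continuous_max _ _ (fun x => x) (fun=> 0)).
  exact: cvg_id.
exact: cvg_cst.
Qed.

Let continuous_step2 : continuous step2.
Proof.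
have cs k z : {for z, continuous (fun t => pos (t - k))}.
  apply: (@continuous_comp _ _ _ (fun t : R => t - k) pos); last exact: continuous_pos.
  by apply: (@cvgB _ R^o); [exact: cvg_id | exact: cvg_cst].
have cm k z : {for z, continuous (fun t => 3 * pos (t - k))}.
  by apply: (@cvgM _ R^o); [exact: cvg_cst | exact: cs].
move=> z; apply: (@cvgB _ R^o); last exact: cs.
apply: (@cvgD _ R^o); last exact: cm.
by apply: (@cvgB _ R^o); [exact: continuous_pos | exact: cm].
Qed.

Let step_bounds z : [/\ 0 <= step z, step z <= 1 & 0 <= step1 z].
Proof.
rewrite /step /step1 /cubp /sqp.
case: (posP z) => -[z0 ->]; case: (posP (z - 1)) => -[z1 ->];
case: (posP (z - 2)) => -[z2 ->]; case: (posP (z - 3)) => -[z3 ->];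
try (exfalso; lra).
- by split; lra.
- have z1' : 0 <= 1 - z by lra.
  have h1 := mulr_ge0 z0 z0; have h2 := mulr_ge0 h1 z1'; have h3 := mulr_ge0 z0 z1'.
  have h4 := mulr_ge0 h1 z0.
  by split; nra.
(* Local coordinate on [1, 2], in which the bounds follow from nonnegative products of [u] and
   [1 - u]. *)
- have [u uE] : exists u, z = u + 1 by exists (z - 1); ring.
  subst z.
  have u0 : 0 <= u by lra.
  have u1 : 0 <= 1 - u by lra.
  have h1 := mulr_ge0 u0 u0; have h2 := mulr_ge0 h1 u1; have h3 := mulr_ge0 u0 u1.
  have h5 := mulr_ge0 u1 u1; have h6 := mulr_ge0 u0 h5.
  by split; nra.
(* On [2, 3] the distance to the right knot is used: there [step] is 1 - u^3 / 6. *)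
- have [u uE] : exists u, z = 3 - u by exists (3 - z); ring.
  subst z.
  have u0 : 0 <= u by lra.
  have u1 : 0 <= 1 - u by lra.
  have h1 := mulr_ge0 u0 u0; have h2 := mulr_ge0 h1 u1; have h3 := mulr_ge0 u0 u1.
  have h5 := mulr_ge0 u1 u1; have h6 := mulr_ge0 u0 h5.
  have h4 := mulr_ge0 h1 u0.
  by split; nra.
- by split; nra.
Qed.

Let step_le0 z : z <= 0 -> [/\ step z = 0, step1 z = 0 & step2 z = 0].
Proof.
move=> z0; rewrite /step /step1 /step2 /cubp /sqp.
have p k : 0 <= k -> pos (z - k) = 0.
  by move=> k0; case: (posP (z - k)) => -[? ->] //; lra.
have p0 : pos z = 0 by rewrite -(subr0 z) p.
by rewrite p0 !p ?ler0n //; split; ring.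
Qed.

Let step_ge3 z : 3 <= z -> [/\ step z = 1, step1 z = 0 & step2 z = 0].
Proof.
move=> z0; rewrite /step /step1 /step2 /cubp /sqp.
have p k : k <= 3 -> pos (z - k) = z - k.
  by move=> k0; case: (posP (z - k)) => -[? ->] //; lra.
have p0 : pos z = z by rewrite -[in LHS](subr0 z) p ?subr0 ?ler0n.
by rewrite p0 !p ?ler_nat ?lexx ?ler1n //; split; field.
Qed.

(** An affine map sends [a, b] onto [0, 3], where [step] rises. A continuous second derivative is
    asked for so that the glued Stein solutions have a bounded one. *)
Lemma smooth_step a b : a < b -> exists q q1 q2 : R -> R,
  [/\ forall z, is_derive z (1 : R) q (q1 z),
      forall z, is_derive z (1 : R) q1 (q2 z) & continuous q2] /\
  [/\ forall z, [/\ 0 <= q z, q z <= 1 & 0 <= q1 z],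
      forall z, z <= a -> [/\ q z = 0, q1 z = 0 & q2 z = 0] &
      forall z, b <= z -> [/\ q z = 1, q1 z = 0 & q2 z = 0]].
Proof.
move=> ab; pose c := 3 / (b - a).
have ba : 0 < b - a by lra.
have c0 : 0 < c by rewrite divr_gt0.
pose t z := c * (z - a).
exists (fun z => step (t z)), (fun z => c * step1 (t z)),
  (fun z => c * (c * step2 (t z))).
split; split => z.
- exact: is_derive_affine.
- have h := @is_derive_affine step1 _ c a z (is_derive_step1 _).
  by apply: is_derive_eq; rewrite /GRing.scale /=; ring.
- apply: (@cvgM _ R^o); first exact: cvg_cst.
  apply: (@cvgM _ R^o); first exact: cvg_cst.
  apply: (@continuous_comp _ _ _ t step2); last exact: continuous_step2.
  apply: (@cvgM _ R^o); first exact: cvg_cst.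
  by apply: (@cvgB _ R^o); [exact: cvg_id | exact: cvg_cst].
- by have [h0 h1 h2] := step_bounds (t z); split => //; rewrite mulr_ge0 // ltW.
- move=> za; have [|-> -> ->] := @step_le0 (t z); last by rewrite !mulr0.
  by rewrite /t; nra.
- move=> zb; have [|-> -> ->] := @step_ge3 (t z); last by rewrite !mulr0.
  by rewrite /t /c mulrAC ler_pdivlMr // ler_pM2l //; lra.
Qed.

End SmoothStep.

Section ContinuousFun.
Context {R : realType}.
Implicit Types f g : R -> R.

Lemma continuousD_fun f g :
  continuous f -> continuous g -> continuous (fun z => f z + g z).
Proof. by move=> cf cg z; apply: (@cvgD _ R^o); [exact: cf | exact: cg]. Qed.

Lemma continuousN_fun f : continuous f -> continuous (fun z => - f z).
Proof. by move=> cf z; apply: (@cvgN _ R^o); exact: cf. Qed.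

Lemma continuousM_fun f g :
  continuous f -> continuous g -> continuous (fun z => f z * g z).
Proof. by move=> cf cg z; apply: (@cvgM _ R^o); [exact: cf | exact: cg]. Qed.

Lemma continuous_cst_fun (c : R) : continuous (fun _ : R => c).
Proof. by move=> z; exact: cvg_cst. Qed.

Lemma continuous_id_fun : continuous (fun z : R => z).
Proof. by move=> z; exact: cvg_id. Qed.

End ContinuousFun.

(** * Stein solutions for half-lines *)

Section SteinTest.
Context {R : realType}.
Implicit Types (x y z : R).

Local Notation phi := (@normal_density R).
Local Notation Phi := (@normal_cdf R).

#[local] Existing Instance is_derive_mills.

Lemma normal_cdf_le1 z : Phi z <= 1.
Proof. by have := normal_cdf_ge0 (- z); rewrite normal_cdfN; lra. Qed.

(** The mirror image [(1 - Phi) / phi], which solves [g' - z g = - 1] and is controlled at plus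
    infinity. *)
Let millsN z := mills (- z).

Let is_derive_millsN z : is_derive z (1 : R) millsN (z * millsN z - 1).
Proof.
have h : is_derive (-1 * (z - 0)) (1 : R) (@mills R) (1 - z * mills (- z)).
  have -> : 1 - z * mills (- z) = 1 + (-1 * (z - 0)) * mills (-1 * (z - 0)).
    by rewrite subr0 mulN1r; ring.
  exact: is_derive_mills.
have := is_derive_affine h.
rewrite (_ : (fun t => _) = millsN).
  by rewrite /millsN; congr is_derive; ring.
by apply/funext => t; rewrite subr0 mulN1r.
Qed.

Lemma is_derive2_quadratic (f f1 f2 : R -> R) C :
  (forall z, is_derive z (1 : R) f (f1 z)) ->
  (forall z, is_derive z (1 : R) f1 (f2 z)) -> (forall z, `|f2 z| <= C) ->
  forall z h, `|f (z + h) - f z - h * f1 z| <= C * h ^+ 2.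
Proof.
move=> d1 d2 bd z h.
have [c hc ->] := is_derive_MVT d1 z (z + h).
have -> : f1 c * (z + h - z) - h * f1 z = h * (f1 c - f1 z) by ring.
have [e _ ->] := is_derive_MVT d2 z c.
have C0 : 0 <= C by rewrite (le_trans _ (bd 0)).
have ch : `|c - z| <= `|h|.
  have [h0|h0] := leP 0 h.
    rewrite (ger0_norm h0) ler_norml.
    by case/orP: hc => /andP[? ?]; apply/andP; split; lra.
  rewrite (ltr0_norm h0) ler_norml.
  by case/orP: hc => /andP[? ?]; apply/andP; split; lra.
rewrite !normrM mulrCA -[h ^+ 2]real_normK ?num_real // expr2.
by rewrite ler_pM // ?mulr_ge0 // ler_pM.
Qed.

(* With A = 1 - Phi y and B = Phi y, the solutions A Phi / phi and
   B (1 - Phi) / phi of the Stein equations on the two sides of y are glued by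
   a smooth step q; the gluing error has the sign of Phi y - Phi z. *)
Lemma stein_test a b y : a < b -> exists (q q1 f f1 : R -> R) (C : R),
  [/\ forall z, [/\ 0 <= q z, q z <= 1 & 0 <= q1 z],
      forall z, z <= a -> q z = 0 /\ q1 z = 0 &
      forall z, b <= z -> q z = 1 /\ q1 z = 0] /\
  [/\ forall z h, `|f (z + h) - f z - h * f1 z| <= C * h ^+ 2,
      forall z, `|f1 z| <= C &
      forall z, f1 z - z * f z =
        1 - q z - Phi y + q1 z * ((Phi y - Phi z) / phi z)].
Proof.
move=> ab; have [q [q1 [q2 [[dq dq1 cq2] [bq qa qb]]]]] := smooth_step ab.
pose A := 1 - Phi y; pose B := Phi y; pose m := @mills R; pose M := millsN.
have Bge := normal_cdf_ge0 y; have Ble := normal_cdf_le1 y.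
pose f z := (1 - q z) * (A * m z) + q z * (B * M z).
pose f1 z := (1 - q z) * (A * (1 + z * m z)) - q1 z * (A * m z)
  + q1 z * (B * M z) + q z * (B * (z * M z - 1)).
pose f2 z := (1 - q z) * (A * (m z + z * (1 + z * m z)))
  - 2 * (q1 z * (A * (1 + z * m z))) - q2 z * (A * m z)
  + q2 z * (B * M z) + 2 * (q1 z * (B * (z * M z - 1)))
  + q z * (B * (M z + z * (z * M z - 1))).
have df z : is_derive z (1 : R) f (f1 z).
  have h1 := dq z; have h2 := is_derive_mills z; have h3 := is_derive_millsN z.
  by apply: is_derive_eq; rewrite /GRing.scale /= /f1 /m /M; ring.
have df1 z : is_derive z (1 : R) f1 (f2 z).
  have h1 := dq z; have h2 := is_derive_mills z; have h3 := is_derive_millsN z.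
  have h4 := dq1 z.
  by apply: is_derive_eq; rewrite /GRing.scale /= /f2 /m /M; ring.
have cf1 : continuous f1 := is_derive_continuous df1.
have cf2 : continuous f2.
  have cq : continuous q := is_derive_continuous dq.
  have cq1 : continuous q1 := is_derive_continuous dq1.
  have cm : continuous m := is_derive_continuous is_derive_mills.
  have cM : continuous M := is_derive_continuous is_derive_millsN.
  (* Abstracting the two Mills ratios to arbitrary continuous functions makes the syntactic rules
     below stop at them. *)
  move: m M cm cM @f2 {f f1 df df1 cf1} => m M cm cM f2; rewrite /f2.
  by repeat match goal with
    | |- continuous (fun z => @?g z + @?h z) => apply: (@continuousD_fun _ g h)
    | |- continuous (fun z => - @?g z) => apply: (@continuousN_fun _ g)
    | |- continuous (fun z => @?g z * @?h z) => apply: (@continuousM_fun _ g h)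
    | |- continuous (fun _ => ?c) => exact: (@continuous_cst_fun _ c)
    | |- continuous (fun z => z) => exact: continuous_id_fun
    | |- _ => assumption
    end.
(* Left of [a] only the solution built from [mills] remains, and [mills_bounds] applies; the compact
   middle is left to continuity. *)
have left_le z : z <= Num.min a (-1) -> `|f1 z| <= 1 /\ `|f2 z| <= 2.
  rewrite le_min => /andP[za z1]; have [h1 h2] := mills_bounds z1.
  have [e0 e1 e2] := qa _ za; rewrite /f1 /f2 e0 e1 e2.
  rewrite !(mul0r, mulr0, subr0, addr0, mul1r) !normrM ger0_norm;
    last by rewrite /A; lra.
  have A1 : A <= 1 by rewrite /A; lra.
  have A0 : 0 <= A by rewrite /A; lra.
  rewrite /m; have := normr_ge0 (1 + z * mills z).
  by have := normr_ge0 (mills z + z * (1 + z * mills z)); split; nra.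
have right_le z : Num.max b 1 <= z -> `|f1 z| <= 1 /\ `|f2 z| <= 2.
  rewrite ge_max => /andP[zb z1].
  have [|h1 h2] := @mills_bounds _ (- z); first by lra.
  have [e0 e1 e2] := qb _ zb; rewrite /f1 /f2 e0 e1 e2.
  rewrite subrr !(mul0r, mulr0, subr0, add0r, addr0, mul1r).
  have -> : z * M z - 1 = - (1 + - z * mills (- z)) by rewrite /M /millsN; ring.
  have -> : M z + z * - (1 + - z * mills (- z)) =
      mills (- z) + - z * (1 + - z * mills (- z)).
    by rewrite /M /millsN; ring.
  rewrite oppr0 !add0r !normrM normrN ger0_norm //.
  have := normr_ge0 (1 + - z * mills (- z)).
  have := normr_ge0 (mills (- z) + - z * (1 + - z * mills (- z))).
  by rewrite /B; split; nra.
have [C1 hC1] := continuous_bounded cf1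
  (fun z h => (left_le z h).1) (fun z h => (right_le z h).1).
have [C2 hC2] := continuous_bounded cf2
  (fun z h => (left_le z h).2) (fun z h => (right_le z h).2).
exists q, q1, f, f1, (Num.max C1 C2); split; split.
- exact: bq.
- by move=> z /qa[].
- by move=> z /qb[].
- move=> z h; apply: (is_derive2_quadratic df df1) => t.
  by rewrite le_max hC2 orbT.
- by move=> z; rewrite le_max hC1.
(* The two Mills equations leave [(1 - q) * A - q * B], that is [1 - q - Phi y]; the gluing term
   [q1 * (B * M - A * m)] has numerator [Phi y - Phi z] up to [q1]. *)
- move=> z; rewrite /f1 /f /m /M /millsN /mills normal_cdfN normal_densityN /A /B.
  by field; rewrite normal_density_neq0.
Qed.

(** The step rises between [x] and [y]: it vanishes for [z <= x], and the gluing error lives left of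
    [y], where [Phi y - Phi z] is nonnegative. *)
Lemma stein_test_upper x y : x < y -> exists (f f1 : R -> R) (C : R),
  [/\ forall z h, `|f (z + h) - f z - h * f1 z| <= C * h ^+ 2,
      forall z, `|f1 z| <= C &
      forall z, (z <= x)%R%:R - Phi y <= f1 z - z * f z].
Proof.
move=> xy; have [q [q1 [f [f1 [C [[bq qa qb] [h1 h2 h3]]]]]]] := stein_test y xy.
exists f, f1, C; split => // z; rewrite h3.
have [q0 qle q10] := bq z.
have : 0 <= q1 z * ((Phi y - Phi z) / phi z).
  have [zy|/ltW yz] := leP z y; last by rewrite (qb _ yz).2 mul0r.
  apply: mulr_ge0 => //; apply: divr_ge0; last exact: ltW (normal_density_gt0 z).
  by rewrite subr_ge0 normal_cdf_homo.
by have [/qa[-> _]|_] := leP z x; rewrite ?mulr1n ?mulr0n; lra.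
Qed.

(** Now the step rises between [y] and [x]: [1 - q] vanishes beyond [x], and the gluing error lives
    right of [y], where it is nonpositive. *)
Lemma stein_test_lower x y : y < x -> exists (f f1 : R -> R) (C : R),
  [/\ forall z h, `|f (z + h) - f z - h * f1 z| <= C * h ^+ 2,
      forall z, `|f1 z| <= C &
      forall z, f1 z - z * f z <= (z <= x)%R%:R - Phi y].
Proof.
move=> yx; have [q [q1 [f [f1 [C [[bq qa qb] [h1 h2 h3]]]]]]] := stein_test y yx.
exists f, f1, C; split => // z; rewrite h3.
have [q0 qle q10] := bq z.
have : q1 z * ((Phi y - Phi z) / phi z) <= 0.
  have [zy|/ltW yz] := leP z y; first by rewrite (qa _ zy).2 mul0r.
  apply: mulr_ge0_le0 => //; apply: mulr_le0_ge0.
    by rewrite subr_le0 normal_cdf_homo.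
  by rewrite invr_ge0 ltW ?normal_density_gt0.
by have [_|/ltW/qb[-> _]] := leP z x; rewrite ?mulr1n ?mulr0n; lra.
Qed.

End SteinTest.

(** * Descents of uniform permutations *)

Lemma sum_pred_le (P : pred nat) (r : seq nat) m :
  (forall j, P j -> j \in r) -> (\sum_(j < m) P j <= size r)%N.
Proof.
move=> Pr; rewrite -(big_mkord xpredT (fun j => P j : nat)).
have -> : (\sum_(0 <= j < m) P j = size [seq j <- index_iota 0 m | P j])%N.
  by rewrite size_filter -sum1_count [RHS]big_mkcond; apply: eq_bigr => j _; case: ifP.
apply: uniq_leq_size; first by rewrite filter_uniq // iota_uniq.
by move=> j; rewrite mem_filter => /andP[/Pr].
Qed.

Section PermSums.
Context {R : realType} {n : nat}.
Implicit Types (w s : 'S_n) (h : 'S_n -> R).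

Definition sgn w : R := (-1) ^+ odd_perm w.

Lemma sum_mulg_left s h : \sum_w h (s * w)%g = \sum_w h w.
Proof. by rewrite [RHS](reindex_inj (mulgI s)). Qed.

Lemma sum_mulg_right s h : \sum_w h (w * s)%g = \sum_w h w.
Proof. by rewrite [RHS](reindex_inj (mulIg s)). Qed.

Lemma sum_antisym s h : (forall w, h (s * w)%g = - h w) -> \sum_w h w = 0.
Proof.
move=> hs; have := sum_mulg_left s h.
under eq_bigr do rewrite hs.
rewrite sumrN => e; lra.
Qed.

Lemma sum_sgn_invariant (p q : 'I_n) h : p != q ->
  (forall w, h (tperm p q * w)%g = h w) -> \sum_w sgn w * h w = 0.
Proof.
move=> pq hs; apply: (@sum_antisym (tperm p q)) => w.
by rewrite hs /sgn odd_mul_tperm pq addTb signrN mulNr.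
Qed.

End PermSums.

(** * Descent signs and their correlations *)

Section DescentSigns.
Context {R : realType} {N : nat}.
Implicit Types (w s : 'S_N.+1) (i j : nat) (f : R -> R).

(** Natural-number indices keep the arithmetic of neighbours simple. Indices above [N] are sent to
    position 0; the guard in [dsign] excludes them. *)
Definition pos i : 'I_N.+1 := inord i.

(* x_i compares the values at the 0-based positions i - 1 and i; the conventions
   x_0 = x_(N+1) = 0 make every i have two neighbours. *)
Definition dsign w i : R :=
  if (0 < i <= N)%N then (if (w (pos i) < w (pos i.-1))%N then 2^-1 else - 2^-1)
  else 0.
Local Notation x := dsign.

Definition dsum w : R := \sum_(i < N.+2) x w i.
Local Notation S := dsum.

Definition dnear w i : R := x w i.-1 + x w i + x w i.+1.
Local Notation Y := dnear.

Lemma val_pos i : (i <= N)%N -> pos i = i :> nat.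
Proof. by move=> iN; rewrite inordK. Qed.

Lemma pos_eq i j : (i <= N)%N -> (j <= N)%N -> (pos i == pos j) = (i == j).
Proof. by move=> iN jN; rewrite -val_eqE /= !val_pos. Qed.

Lemma dsign_out w i : ~~ (0 < i <= N)%N -> x w i = 0.
Proof. by rewrite /dsign => /negbTE ->. Qed.

Lemma dsign_eq w w' i : w' (pos i) = w (pos i) -> w' (pos i.-1) = w (pos i.-1) ->
  x w' i = x w i.
Proof. by rewrite /dsign => -> ->. Qed.

Lemma dsign_norm w i : `|x w i| <= 2^-1.
Proof.
by rewrite /dsign; case: ifP => _; [case: ifP => _|]; rewrite ?normrN ger0_norm //; lra.
Qed.

Lemma dsign_sqr w i : x w i * x w i = (0 < i <= N)%N%:R / 4.
Proof. by rewrite /dsign; case: ifP => _; [case: ifP => _|]; rewrite /=; field. Qed.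

Lemma dnear_norm w i : `|Y w i| <= 3 / 2.
Proof.
have h1 := dsign_norm w i.-1; have h2 := dsign_norm w i; have h3 := dsign_norm w i.+1.
rewrite (le_trans (ler_normD _ _)) // (le_trans (lerD (ler_normD _ _) (lexx _))) //.
lra.
Qed.

Lemma des_dsum w : (des w)%:R = S w + N%:R / 2.
Proof.
rewrite /dsum big_ord_recl /= dsign_out // add0r.
(* Each of the first [N] descent indicators is a sign plus 1/2; the last position has no successor
   and contributes 0 on both sides. *)
have -> : N%:R / 2 = \sum_(i < N.+1) (i < N)%N%:R / 2 :> R.
  rewrite big_ord_recr /= ltnn mul0r addr0.
  under eq_bigr do rewrite ltn_ord.
  by rewrite sumr_const card_ord -[RHS]mulr_natl mul1r.
rewrite -big_split /= /des -sum1_card natr_sum big_mkcond /=.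
apply: eq_bigr => i _; rewrite inE /bump /= add1n /dsign /=.
have ip : pos i = i by apply: val_inj; rewrite /= val_pos // -ltnS ltn_ord.
case: (boolP (i < N)%N) => iN /=.
  rewrite ip; case: existsP => [[j /andP[/eqP ji jw]]|hj].
    have -> : pos i.+1 = j by apply: val_inj; rewrite /= val_pos // ji.
    by rewrite jw; field.
  case: ifP => hw; last by field.
  by case: hj; exists (pos i.+1); rewrite hw val_pos ?eqxx.
case: existsP => [[j /andP[/eqP ji _]]|_]; last by field.
by have := ltn_ord j; rewrite ji ltnS (negbTE iN).
Qed.

Definition swap i := tperm (pos i.-1) (pos i).

Lemma dsign_swap w i : x (swap i * w)%g i = - x w i.
Proof.
rewrite /dsign; case: ifP => [/andP[i0 iN]|_]; last by rewrite oppr0.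
rewrite !permM tpermL tpermR.
have : w (pos i) != w (pos i.-1).
  by rewrite (inj_eq perm_inj) pos_eq //; lia.
by rewrite -val_eqE /=; case: ltngtP => // _ _; rewrite opprK.
Qed.

Lemma perm_swap_out w i j : (0 < i <= N)%N -> (j <= N)%N -> j != i -> j != i.-1 ->
  (swap i * w)%g (pos j) = w (pos j).
Proof.
by move=> iN jN ji ji1; rewrite permM tpermD // pos_eq //; lia.
Qed.

Lemma dsign_swap_out w i j : (0 < i <= N)%N -> (j < i.-1)%N || (i.+1 < j)%N ->
  x (swap i * w)%g j = x w j.
Proof.
move=> iN ij; have [jN|jN] := boolP (0 < j <= N)%N; last by rewrite !dsign_out.
by apply: dsign_eq; rewrite perm_swap_out //; lia.
Qed.

Lemma sum_three (g : nat -> R) i : (0 < i <= N)%N ->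
  (forall j, (j < i.-1)%N || (i.+1 < j)%N -> g j = 0) ->
  \sum_(j < N.+2) g j = g i.-1 + g i + g i.+1.
Proof.
move=> iN g0; rewrite -(big_mkord xpredT g).
rewrite (@big_cat_nat _ _ _ i.-1) //=; last by lia.
rewrite big_nat big1 ?add0r => [|j hj]; last by apply: g0; lia.
rewrite (@big_cat_nat _ _ _ i.+2) //=; [|lia|lia].
rewrite [X in _ + X]big_nat [X in _ + X]big1 ?addr0 => [|j hj]; last by apply: g0; lia.
case: i iN {g0} => // i iN; rewrite /=.
by rewrite !big_nat_recl ?big_geq ?addr0 ?addrA //; lia.
Qed.

(** [S - Y] collects the signs outside the block around [i], and none of them reads a swapped
    position. *)
Lemma dsum_swap w i : (0 < i <= N)%N ->
  S (swap i * w)%g - Y (swap i * w)%g i = S w - Y w i.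
Proof.
move=> iN; set w' := (_ * _)%g.
suff : S w' - S w = Y w' i - Y w i by lra.
rewrite /dsum -sumrB (@sum_three (fun j => x w' j - x w j) i) //.
  by rewrite /dnear; ring.
by move=> j hj; rewrite dsign_swap_out // subrr.
Qed.

(** The summand is antisymmetric under [swap i]. This is the exchange identity on which the Stein
    bound rests. *)
Lemma sum_dsign_far i f : \sum_w x w i * f (S w - Y w i) = 0.
Proof.
have [iN|iN] := boolP (0 < i <= N)%N; last first.
  by apply: big1 => w _; rewrite dsign_out // mul0r.
apply: (@sum_antisym _ _ (swap i)) => w.
by rewrite dsum_swap // dsign_swap mulNr.
Qed.

(* Centred, since E[x_i x_(i+1)] = - 1 / 12. *)
Definition dpair w i : R :=
  if (0 < i < N)%N then x w i * x w i.+1 + 12^-1 else 0.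

Lemma dpair_norm w i : `|dpair w i| <= 3^-1.
Proof.
rewrite /dpair /dsign; case: ifP => [/andP[i0 iN]|_]; last by rewrite normr0; lra.
rewrite i0 (ltnW iN) /= iN ler_norml.
by case: ifP => _; case: ifP => _; apply/andP; split; lra.
Qed.

Definition rot3 i : 'S_N.+1 :=
  (tperm (pos i.-1) (pos i) * tperm (pos i) (pos i.+1))%g.

Lemma rot3E w i : (0 < i < N)%N ->
  [/\ (rot3 i * w)%g (pos i.-1) = w (pos i.+1),
      (rot3 i * w)%g (pos i) = w (pos i.-1) &
      (rot3 i * w)%g (pos i.+1) = w (pos i)].
Proof.
move=> iN; rewrite !permM tpermL tpermR tpermL.
rewrite (@tpermD _ _ _ (pos i.-1)) ?pos_eq; try lia.
by rewrite (@tpermD _ _ _ (pos i.+1)) ?pos_eq ?tpermR //; lia.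
Qed.

Lemma rot3_out w i j : (0 < i < N)%N -> (j <= N)%N -> (i.+1 < j)%N ->
  (rot3 i * w)%g (pos j) = w (pos j).
Proof. by move=> iN jN ij; rewrite !permM !tpermD // pos_eq //; lia. Qed.

(** Exactly one of the three rotations of three distinct values is monotone: the products of signs
    are 1/4 once and -1/4 twice, and their sum cancels the three constants 1/12. *)
Lemma dpair_rot3 w i : (0 < i < N)%N ->
  dpair w i + dpair (rot3 i * w)%g i + dpair (rot3 i * (rot3 i * w))%g i = 0.
Proof.
move=> iN; have [e1 e2 e3] := rot3E w iN.
have [e4 e5 e6] := rot3E (rot3 i * w)%g iN.
rewrite /dpair iN /dsign /= e4 e5 e6 e1 e2 e3.
have [i0 iN1] := andP iN; rewrite i0 iN1 (ltnW iN1) /=.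
have hab : w (pos i.-1) != w (pos i) by rewrite (inj_eq perm_inj) pos_eq; lia.
have hbc : w (pos i) != w (pos i.+1) by rewrite (inj_eq perm_inj) pos_eq; lia.
have hac : w (pos i.-1) != w (pos i.+1) by rewrite (inj_eq perm_inj) pos_eq; lia.
move: hab hbc hac; rewrite -!val_eqE /=.
set a := nat_of_ord (w (pos i.-1)); set b := nat_of_ord (w (pos i)).
set c := nat_of_ord (w (pos i.+1)).
case: (ltngtP a b) => // ab; case: (ltngtP b c) => // bc;
case: (ltngtP a c) => // ac _ _ _; try lia; by field.
Qed.

Lemma sum_dpair_mul i (g : 'S_N.+1 -> R) :
  (forall w, g (rot3 i * w)%g = g w) -> \sum_w dpair w i * g w = 0.
Proof.
move=> hg; have [iN|iN] := boolP (0 < i < N)%N; last first.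
  by apply: big1 => w _; rewrite /dpair (negbTE iN) mul0r.
pose h w := dpair w i * g w.
have e1 := sum_mulg_left (rot3 i) h.
have e2 : \sum_w h (rot3 i * (rot3 i * w))%g = \sum_w h w.
  rewrite -[RHS](sum_mulg_left (rot3 i * rot3 i)%g).
  by apply: eq_bigr => w _; rewrite mulgA.
have : \sum_w (h w + h (rot3 i * w)%g + h (rot3 i * (rot3 i * w))%g) = 0.
  apply: big1 => w _; rewrite /h !hg -!mulrDl dpair_rot3 //; exact: mul0r.
rewrite !big_split /= e1 e2 /h => e; lra.
Qed.

Lemma sum_dpair i : \sum_w dpair w i = 0.
Proof.
rewrite -[RHS](@sum_dpair_mul i (fun=> 1)) //.
by apply: eq_bigr => w _; rewrite mulr1.
Qed.

(** [dpair w j] reads only the positions from [j - 1] to [j + 1], all beyond [i + 1] and hence fixed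
    by [rot3 i]. *)
Lemma sum_dpair2 i j : (i.+2 < j)%N -> \sum_w dpair w i * dpair w j = 0.
Proof.
move=> ij; have [iN|iN] := boolP (0 < i < N)%N; last first.
  by apply: big1 => w _; rewrite /dpair (negbTE iN) mul0r.
apply: sum_dpair_mul => w; rewrite /dpair; case: ifP => // jN.
have [j0 jN'] := andP jN.
by congr (_ * _ + _); apply: dsign_eq; rewrite rot3_out //=; lia.
Qed.

Local Notation M := (#|{: 'S_N.+1}|%:R : R).

Lemma sum_near_le (i m : nat) :
  (\sum_(j < m) ((i <= j.+2) && (j <= i.+2)) <= 5)%N.
Proof.
apply: (@leq_trans (size (iota (i - 2) 5))) => //.
apply: (@sum_pred_le (fun j => (i <= j.+2) && (j <= i.+2))%N) => j.
by rewrite mem_iota => hj; lia.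
Qed.

(** Only indices at distance at most 2 contribute: at most five [j] for each [i], each with average
    at most 1/9. *)
Lemma sum_dpair_sqr :
  \sum_w (\sum_(i < N.+2) dpair w i) ^+ 2 <= M * (5 / 9 * N.+2%:R).
Proof.
under eq_bigr => w _ do rewrite expr2 big_distrlr /=.
rewrite exchange_big /=.
under eq_bigr => i _ do rewrite exchange_big /=.
have bnd (i j : 'I_N.+2) : \sum_w dpair w i * dpair w j <=
    M / 9 * ((i <= j.+2) && (j <= i.+2))%N%:R.
  case: (boolP ((i <= j.+2) && (j <= i.+2))%N) => /= [_|].
    rewrite mulr1 mulr_natl -sumr_const ler_sum // => w _.
    rewrite (le_trans (ler_norm _)) // normrM.
    rewrite (le_trans (ler_pM _ _ (dpair_norm _ _) (dpair_norm _ _))) //.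
    lra.
  rewrite negb_and -!ltnNge mulr0 => /orP[ij|ij]; last by rewrite sum_dpair2.
  by under eq_bigr do rewrite mulrC; rewrite sum_dpair2.
have cnt (i : 'I_N.+2) : \sum_(j < N.+2) ((i <= j.+2) && (j <= i.+2))%N%:R <= 5 :> R.
  by rewrite -natr_sum (ler_nat _ _ 5) sum_near_le.
apply: (@le_trans _ _ (\sum_(i < N.+2) (M / 9 * 5))).
  apply: ler_sum => i _.
  apply: (@le_trans _ _ (\sum_(j < N.+2)
      (M / 9 * ((i <= j.+2) && (j <= i.+2))%N%:R))).
    by apply: ler_sum => j _; exact: bnd.
  by rewrite -mulr_sumr ler_wpM2l ?cnt // divr_ge0.
rewrite sumr_const card_ord -mulr_natr.
by rewrite le_eqVlt; apply/orP; left; apply/eqP; field.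
Qed.

End DescentSigns.

(** * Variance and Stein bound over the symmetric group *)

Section SteinBound.
Context {R : realType} {N : nat}.
Context (N_gt0 : (0 < N)%N).
Implicit Types (w s : 'S_N.+1) (i j : nat) (f : R -> R).

Local Notation x := (@dsign R N).
Local Notation S := (@dsum R N).
Local Notation Y := (@dnear R N).
Local Notation M := (#|{: 'S_N.+1}|%:R : R).

Lemma sum_interval (m K : nat) : (K <= m)%N ->
  \sum_(i < m.+1) (0 < i <= K)%N%:R = K%:R :> R.
Proof.
move=> Km; rewrite -natr_sum; congr (_%:R); rewrite big_ord_recl /= add0n.
rewrite -[RHS](minn_idPr Km); elim: m {Km} => [|m IH].
  by rewrite big_ord0 min0n.
rewrite big_ord_recr /= IH /bump /= add1n; lia.
Qed.

(** The squares give N/4, and centring the N - 1 neighbouring products, each counted twice, costs (N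
    - 1)/6; the difference is (N + 2)/12. *)
Lemma sum_dsign_dnear w : \sum_(i < N.+2) x w i * Y w i =
  N.+2%:R / 12 + 2 * \sum_(i < N.+2) dpair w i.
Proof.
have x0 : x w 0 = 0 by rewrite dsign_out.
have xN : x w N.+1 = 0 by rewrite dsign_out // ltnn andbF.
pose T := \sum_(i < N.+2) x w i * x w i.+1.
have e1 : \sum_(i < N.+2) x w i * x w i.-1 = T.
  rewrite big_ord_recl /= x0 mul0r add0r /T [RHS]big_ord_recr /= xN mul0r addr0.
  by apply: eq_bigr => i _; rewrite /bump /= add1n /= mulrC.
have e2 : \sum_(i < N.+2) x w i * x w i = N%:R / 4.
  under eq_bigr do rewrite dsign_sqr.
  by rewrite -mulr_suml sum_interval.
have e3 : \sum_(i < N.+2) dpair w i = T + N.-1%:R / 12.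
  rewrite -(@sum_interval N.+1 N.-1); last by lia.
  rewrite mulr_suml /T -big_split /=.
  apply: eq_bigr => i _; rewrite /dpair.
  have -> : (0 < i <= N.-1)%N = (0 < i < N)%N by lia.
  case: ifP => hi; first by rewrite mul1r.
  have [->|i0] := posnP i; first by rewrite x0 !mul0r addr0.
  by rewrite (@dsign_out _ _ w i.+1) ?mulr0 ?mul0r ?addr0 //; lia.
have -> : \sum_(i < N.+2) x w i * Y w i = T + N%:R / 4 + T.
  rewrite -[X in X + _ + _]e1 -e2 /T -!big_split /=.
  by apply: eq_bigr => i _; rewrite /dnear; ring.
rewrite e3 -(prednK N_gt0) /=; set k := N.-1.
by rewrite -[k.+3]/(3 + k)%N -[k.+1]/(1 + k)%N !natrD; field.
Qed.

(** Split the square into the sums of x_i (S - Y_i) and of x_i Y_i: the first averages to zero by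
    [sum_dsign_far], and in the second the [dpair] are centred. *)
Lemma sum_dsum_sqr : \sum_w S w ^+ 2 = M * (N.+2%:R / 12).
Proof.
have -> : \sum_w S w ^+ 2 =
    \sum_w (\sum_(i < N.+2) x w i * (S w - Y w i) + \sum_(i < N.+2) x w i * Y w i).
  apply: eq_bigr => w _; rewrite -big_split /= expr2 {1}/dsum mulr_suml.
  by apply: eq_bigr => i _; rewrite -mulrDr subrK.
rewrite big_split /= exchange_big /= big1 ?add0r => [|i _]; last first.
  exact: (sum_dsign_far i id).
under eq_bigr do rewrite sum_dsign_dnear.
rewrite big_split /= -[X in _ + X]mulr_sumr exchange_big /=.
rewrite [X in 2 * X]big1 ?mulr0 ?addr0.
  by rewrite sumr_const -[LHS]mulr_natl.
by move=> i _; exact: sum_dpair.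
Qed.

Lemma sum_dsum : \sum_w S w = 0.
Proof.
rewrite exchange_big /= big1 // => i _.
rewrite -[RHS](@sum_dsign_far R N i (fun=> 1)).
by apply: eq_bigr => w _; rewrite mulr1.
Qed.

Section Bound.
Context (f f1 : R -> R) (C sigma : R).
Context (sigma_gt0 : 0 < sigma) (sigma_sqr : sigma ^+ 2 = N.+2%:R / 12).
Context (f_quad : forall z h, `|f (z + h) - f z - h * f1 z| <= C * h ^+ 2)
  (f1_le : forall z, `|f1 z| <= C).

Let C_ge0 : 0 <= C. Proof. exact: le_trans (f1_le 0). Qed.

Let T w : R := \sum_(i < N.+2) dpair w i.
(** Remainder of the first-order Taylor expansion when the block around [i] is removed. *)
Let rest w i := f (S w / sigma - Y w i / sigma) - f (S w / sigma)
  + Y w i / sigma * f1 (S w / sigma).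

(** Each x_i f(S / sigma) is compared with x_i f((S - Y_i) / sigma), whose average is zero. The
    first-order terms add up to [f1] times 1 + 2 T / sigma^2, and the 1 cancels the leading [f1]. *)
Let stein_split w : f1 (S w / sigma) - S w / sigma * f (S w / sigma) =
  - (f1 (S w / sigma) * (2 * T w) / sigma ^+ 2)
  + \sum_(i < N.+2) x w i / sigma * rest w i
  - \sum_(i < N.+2) sigma^-1 * (x w i * f ((S w - Y w i) / sigma)).
Proof.
have s0 : sigma != 0 by rewrite gt_eqF.
rewrite -addrA -sumrB.
have -> : \sum_(i < N.+2) (x w i / sigma * rest w i -
      sigma^-1 * (x w i * f ((S w - Y w i) / sigma))) =
    \sum_(i < N.+2) (x w i * (- (f (S w / sigma) / sigma))
      + x w i * Y w i * (f1 (S w / sigma) / sigma ^+ 2)).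
  by apply: eq_bigr => i _; rewrite /rest -mulrBl; field.
rewrite big_split /= -!mulr_suml sum_dsign_dnear -sigma_sqr -/(T w) -/(S w).
by field.
Qed.

(** 9/8 is the product of the bounds 1/2 on the sign and 9/4 on the squared block. *)
Let rest_le w i : `|x w i / sigma * rest w i| <= 9 / 8 * C / sigma ^+ 3.
Proof.
have h : `|rest w i| <= C * (- (Y w i / sigma)) ^+ 2.
  have := f_quad (S w / sigma) (- (Y w i / sigma)).
  by rewrite /rest; congr (`|_| <= _); ring.
have Y2 : Y w i ^+ 2 <= 9 / 4.
  have h0 := normr_ge0 (Y w i); have h1 := @dnear_norm R N w i.
  by have := ler_pM h0 h0 h1 h1; rewrite -expr2 real_normK ?num_real //; lra.
have iv : 0 < sigma^-1 by rewrite invr_gt0.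
have h2 : `|rest w i| <= C * (9 / 4 * (sigma^-1) ^+ 2).
  apply: le_trans h _; rewrite sqrrN exprMn ler_wpM2l // ler_wpM2r //.
  by rewrite exprn_ge0 // ltW.
have h1 : `|x w i / sigma| <= 2^-1 * sigma^-1.
  by rewrite normrM (gtr0_norm iv) ler_wpM2r ?dsign_norm // ltW.
rewrite normrM (le_trans (ler_pM _ _ h1 h2)) //.
by rewrite le_eqVlt; apply/orP; left; apply/eqP; field; rewrite gt_eqF.
Qed.

(** The inequality 2 sigma |2 T| <= sigma^2 + (2 T)^2 trades the absolute value of [T] for its
    square, whose average [sum_dpair_sqr] bounds. *)
Let main_le w : `|f1 (S w / sigma) * (2 * T w) / sigma ^+ 2| <=
  C / (2 * sigma ^+ 2) * (sigma + 4 / sigma * T w ^+ 2).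
Proof.
have s0 : sigma != 0 by rewrite gt_eqF.
have h : `|2 * T w| <= 2^-1 * (sigma + 4 / sigma * T w ^+ 2).
  rewrite -(ler_pM2l sigma_gt0).
  have -> : sigma * (2^-1 * (sigma + 4 / sigma * T w ^+ 2)) =
      2^-1 * (sigma ^+ 2 + (2 * T w) ^+ 2) by field.
  have := sqr_ge0 (sigma - `|2 * T w|).
  rewrite -[(2 * T w) ^+ 2]real_normK ?num_real // sqrrB.
  by have := normr_ge0 (2 * T w); lra.
rewrite 2!normrM [X in _ * X]gtr0_norm ?invr_gt0 ?exprn_gt0 //.
have -> : C / (2 * sigma ^+ 2) * (sigma + 4 / sigma * T w ^+ 2) =
    C * (2^-1 * (sigma + 4 / sigma * T w ^+ 2)) / sigma ^+ 2 by field.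
by rewrite ler_wpM2r ?invr_ge0 ?exprn_ge0 ?(ltW sigma_gt0) // ler_pM.
Qed.

Lemma stein_bound :
  `|\sum_w (f1 (S w / sigma) - S w / sigma * f (S w / sigma))| <=
  M * (28 * C / sigma).
Proof.
have s0 : sigma != 0 by rewrite gt_eqF.
under eq_bigr => w _ do rewrite stein_split.
rewrite sumrB [X in _ - X]exchange_big /= [X in _ - X]big1 ?subr0; last first.
  move=> i _; rewrite -mulr_sumr (sum_dsign_far i (fun y => f (y / sigma))).
  exact: mulr0.
apply: le_trans (ler_norm_sum _ _ _) _.
(* 83/6 comes from the [T] term, 27/2 from 12 sigma^2 Taylor remainders, and 2/3 rounds the total up
   to 28. *)
have -> : M * (28 * C / sigma) = M * (83 / 6 * C / sigma) + M * (27 / 2 * C / sigma)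
  + M * (2 / 3 * C / sigma) by field.
apply: ler_wpDr; first by rewrite mulr_ge0 // divr_ge0 ?mulr_ge0 ?(ltW sigma_gt0).
apply: (@le_trans _ _ (\sum_w (C / (2 * sigma ^+ 2) * (sigma + 4 / sigma * T w ^+ 2)
    + 27 / 2 * C / sigma))).
  apply: ler_sum => w _; rewrite (le_trans (ler_normD _ _)) // normrN lerD //.
  apply: le_trans (ler_norm_sum _ _ _) _.
  apply: (@le_trans _ _ (\sum_(i < N.+2) (9 / 8 * C / sigma ^+ 3))).
    by apply: ler_sum => i _; exact: rest_le.
  rewrite sumr_const card_ord -[X in X <= _]mulr_natl.
  have -> : N.+2%:R = 12 * sigma ^+ 2 by rewrite sigma_sqr; field.
  by rewrite le_eqVlt; apply/orP; left; apply/eqP; field.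
have cst (c : R) : \sum_(w : 'S_N.+1) c = M * c.
  by rewrite sumr_const -[LHS]mulr_natl.
rewrite big_split /= -mulr_sumr big_split /= -mulr_sumr !cst lerD2r.
have -> : M * (83 / 6 * C / sigma) = C / (2 * sigma ^+ 2) *
   (M * sigma + 4 / sigma * (M * (5 / 9 * (12 * sigma ^+ 2)))) by field.
apply: ler_wpM2l.
  by rewrite divr_ge0 // mulr_ge0 // exprn_ge0 // ltW.
rewrite lerD2l; apply: ler_wpM2l; first by rewrite divr_ge0 // ltW.
have -> : 12 * sigma ^+ 2 = N.+2%:R by rewrite sigma_sqr; field.
exact: sum_dpair_sqr.
Qed.

End Bound.

End SteinBound.

(** * Permutations of a given sign *)

Section SignedSums.
Context {R : realType} {N : nat}.
Implicit Types (w : 'S_N.+1) (i j : nat).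

Local Notation x := (@dsign R N).
Local Notation S := (@dsum R N).
Local Notation sgn := (@sgn R N.+1).
Local Notation M := (#|{: 'S_N.+1}|%:R : R).

Lemma exists_two_outside (A : seq 'I_N.+1) : (size A + 1 < N.+1)%N ->
  exists p q, [/\ p != q, p \notin A & q \notin A].
Proof.
move=> hA.
have /card_gt1P[p [q [hp hq pq]]] : (1 < #|[predC A]|)%N.
  apply: (@leq_trans (N.+1 - size A)); first by lia.
  by rewrite -[X in (X - _)%N]card_ord -(cardC (mem A)) leq_subLR leq_add2r card_size.
by exists p, q; split.
Qed.

Lemma dsign_tperm w p q i : p \notin [:: pos i.-1; pos i] ->
  q \notin [:: pos i.-1; pos i] -> x (tperm p q * w)%g i = x w i.
Proof.
rewrite !inE !negb_or => /andP[p1 p2] /andP[q1 q2].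
by apply: dsign_eq; rewrite permM tpermD.
Qed.

(** At most four of at least six positions are read, so two others can be transposed; a single sign,
    below, needs only four positions in all. *)
Lemma sum_sgn_dsign_mul i j : (5 <= N)%N -> \sum_w sgn w * (x w i * x w j) = 0.
Proof.
move=> N5; have [|p [q [pq]]] :=
    @exists_two_outside ([:: pos i.-1; pos i] ++ [:: pos j.-1; pos j]).
  by rewrite /=; lia.
rewrite !mem_cat => /norP[pi pj] /norP[qi qj].
apply: (sum_sgn_invariant pq) => w.
by rewrite (dsign_tperm _ pi qi) (dsign_tperm _ pj qj).
Qed.

Lemma sum_sgn_dsign i : (3 <= N)%N -> \sum_w sgn w * x w i = 0.
Proof.
move=> N3; have [|p [q [pq pi qi]]] := @exists_two_outside [:: pos i.-1; pos i].
  by rewrite /=; lia.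
by apply: (sum_sgn_invariant pq) => w; rewrite dsign_tperm.
Qed.

Lemma sum_sgn_dsum : (3 <= N)%N -> \sum_w sgn w * S w = 0.
Proof.
move=> N3; under eq_bigr do rewrite mulr_sumr.
by rewrite exchange_big /= big1 // => i _; exact: sum_sgn_dsign.
Qed.

Lemma sum_sgn_dsum_sqr : (5 <= N)%N -> \sum_w sgn w * S w ^+ 2 = 0.
Proof.
move=> N5; under eq_bigr do rewrite expr2 big_distrlr mulr_sumr.
rewrite exchange_big /= big1 // => i _.
under eq_bigr do rewrite mulr_sumr.
by rewrite exchange_big /= big1 // => j _; exact: sum_sgn_dsign_mul.
Qed.

(** * Exchanging the values 0 and 1 *)

Section Transfer.
Context (N_gt0 : (0 < N)%N).

Let v0 : 'I_N.+1 := pos 0.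
Let v1 : 'I_N.+1 := pos 1.
Let consecutive (a b : nat) := (b == a.+1) || (a == b.+1).

Let v01 : v0 != v1. Proof. by rewrite pos_eq. Qed.

(** The inverse gives the positions of the values 0 and 1. *)
Let close w := consecutive (w^-1%g v0) (w^-1%g v1).

Let sum_consecutive_perm w : (\sum_(k | k != v0) consecutive (w v0) (w k) <= 2)%N.
Proof.
apply: (@leq_trans (\sum_k consecutive (w v0) (w k))).
  by rewrite [leqRHS](bigD1 v0) //= leq_addl.
rewrite -(reindex_inj (@perm_inj _ w) (P := xpredT)
  (F := fun l : 'I_N.+1 => consecutive (w v0) l : nat)) /=.
apply: (@leq_trans (size [:: (w v0).-1; (w v0).+1])) => //.
apply: (@sum_pred_le (consecutive (w v0))) => j.
by rewrite !inE /consecutive => /orP[/eqP->|/eqP->]; rewrite ?eqxx ?orbT.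
Qed.

(** Inversion turns [v0] and [v1] into positions. By symmetry [v1] may be replaced by any of the [N]
    positions other than [v0], and for each [w] at most two of them carry a neighbour of [w v0]. *)
Lemma sum_close_le : \sum_w (close w)%:R <= M * (2 / N%:R) :> R.
Proof.
have N0 : 0 < N%:R :> R by rewrite ltr0n.
rewrite mulrA ler_pdivlMr // mulrC.
have e1 : \sum_w (close w)%:R = \sum_(w : 'S_N.+1) (consecutive (w v0) (w v1))%:R :> R.
  rewrite [RHS](reindex_inj invg_inj); exact: eq_bigr.
have e2 (k : 'I_N.+1) : k != v0 ->
    \sum_(w : 'S_N.+1) (consecutive (w v0) (w k))%:R = \sum_w (close w)%:R :> R.
  move=> k0; rewrite e1.
  rewrite -[LHS](sum_mulg_left (tperm v1 k)); apply: eq_bigr => w _.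
  by rewrite !permM tpermR tpermD // eq_sym.
have <- : \sum_(k | k != v0) \sum_(w : 'S_N.+1) (consecutive (w v0) (w k))%:R =
    N%:R * \sum_w (close w)%:R :> R.
  rewrite (eq_bigr _ e2) sumr_const -[LHS]mulr_natl; congr (_%:R * _).
  by rewrite (eq_card (B := predC1 v0)) // cardC1 card_ord.
rewrite exchange_big /= mulr_natl -sumr_const ler_sum // => w _.
by rewrite -natr_sum (ler_nat _ _ 2) sum_consecutive_perm.
Qed.

(** Exchanging 0 and 1 alters only the comparison of these two values with each other, which no sign
    makes unless they are adjacent. *)
Let dsign_close w i : ~~ close w -> x (w * tperm v0 v1)%g i = x w i.
Proof.
move=> hw; have [iN|iN] := boolP (0 < i <= N)%N; last by rewrite !dsign_out.
rewrite /dsign iN !permM.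
set a := w (pos i); set b := w (pos i.-1).
have ab : a != b by rewrite (inj_eq perm_inj) pos_eq; lia.
have wa : w^-1%g a = pos i by rewrite permK.
have wb : w^-1%g b = pos i.-1 by rewrite permK.
have v0E : v0 = 0 :> nat by rewrite val_pos.
have v1E : v1 = 1 :> nat by rewrite val_pos.
suff -> : (tperm v0 v1 a < tperm v0 v1 b)%N = (a < b)%N by [].
have n01 : ~ (a = v0 /\ b = v1).
  move=> [a0 b1]; move/negP: hw; apply.
  by rewrite /close -a0 -b1 wa wb /consecutive !val_pos; lia.
have n10 : ~ (a = v1 /\ b = v0).
  move=> [a1 b0]; move/negP: hw; apply.
  by rewrite /close -a1 -b0 wa wb /consecutive !val_pos; lia.
move: ab; rewrite -val_eqE.
have neq (c d : 'I_N.+1) : c <> d -> c <> d :> nat by move=> cd /val_inj.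
case: tpermP => [a0|a1|/neq a0 /neq a1]; case: tpermP => [b0|b1|/neq b0 /neq b1].
- by rewrite a0 b0 eqxx.
- by case: n01.
- by rewrite a0 v0E v1E /=; lia.
- by case: n10.
- by rewrite a1 b1 eqxx.
- by rewrite a1 v0E v1E /=; lia.
- by rewrite b0 v0E v1E /=; lia.
- by rewrite b1 v0E v1E /=; lia.
- by [].
Qed.

(* Exchanging the values 0 and 1 when they are not adjacent preserves the
   descent set and reverses the sign. *)
Lemma sum_sgn_dsum_le (g : R -> R) : (forall z, `|g z| <= 1) ->
  `|\sum_w sgn w * g (S w)| <= M * (2 / N%:R).
Proof.
move=> g1; pose t := tperm v0 v1.
have closeM w : close (w * t)%g = close w.
  rewrite /close invMg tpermV !permM tpermL tpermR /consecutive orbC.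
  by congr (_ || _); rewrite eq_sym.
pose h w := (~~ close w)%:R * (sgn w * g (S w)).
have h0 : \sum_w h w = 0.
  have := sum_mulg_right t h.
  have e w : h (w * t)%g = - h w.
    rewrite /h closeM; case: (boolP (close w)) => [_|cw]; first by rewrite !mul0r oppr0.
    have -> : S (w * t)%g = S w by apply: eq_bigr => i _; rewrite dsign_close.
    by rewrite /sgn odd_permM odd_tperm v01 addbT signrN mulNr mulrN.
  under eq_bigr do rewrite e.
  rewrite sumrN => e'; lra.
have -> : \sum_w sgn w * g (S w) = \sum_w (close w)%:R * (sgn w * g (S w)).
  rewrite -[RHS]addr0 -[X in _ = _ + X]h0 -big_split /=; apply: eq_bigr => w _.
  by rewrite -mulrDl; case: (close w); rewrite ?addr0 ?add0r mul1r.
apply: le_trans sum_close_le; apply: le_trans (ler_norm_sum _ _ _) _.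
apply: ler_sum => w _; rewrite !normrM normr_nat normr_sign mul1r.
by rewrite ler_piMr.
Qed.

End Transfer.

(** The indicator of a sign class is half of 1 plus [(-1) ^+ s * sgn w]. *)
Lemma sum_signed_perms (s : bool) (h : 'S_N.+1 -> R) :
  \sum_(w in signed_perms N.+1 s) h w =
  2^-1 * (\sum_w h w + (-1) ^+ s * \sum_w sgn w * h w).
Proof.
rewrite big_mkcond mulr_sumr -big_split mulr_sumr /=; apply: eq_bigr => w _.
rewrite inE /sgn; case: (odd_perm w); case: s; rewrite /= ?expr0 ?expr1; by field.
Qed.

Lemma card_signed_perms (s : bool) : (0 < N)%N ->
  #|signed_perms N.+1 s|%:R = 2^-1 * M :> R.
Proof.
move=> N0; have -> : #|signed_perms N.+1 s|%:R = \sum_(w in signed_perms N.+1 s) 1 :> R.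
  by rewrite sumr_const.
rewrite sum_signed_perms.
have -> : \sum_w sgn w * 1 = 0.
  by apply: (@sum_sgn_invariant _ _ (pos 0) (pos 1)) => //; rewrite pos_eq.
by rewrite mulr0 addr0 sumr_const.
Qed.

Lemma card_perms_gt0 : 0 < M.
Proof. by rewrite ltr0n; apply/card_gt0P; exists 1%g. Qed.

End SignedSums.

(** * Convergence of the distribution functions *)

Section AverageLimit.
Context {R : realType}.
Implicit Types (s : bool) (N : nat).

Definition signed_avg s N (g : R -> R) : R :=
  (\sum_(w in signed_perms N.+1 s) g (dsum w)) / #|signed_perms N.+1 s|%:R.

Lemma signed_avgE s N g : (0 < N)%N -> signed_avg s N g =
  (\sum_(w : 'S_N.+1) g (dsum w) + (-1) ^+ s * \sum_(w : 'S_N.+1) sgn w * g (dsum w))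
    / #|{: 'S_N.+1}|%:R.
Proof.
move=> N0; rewrite /signed_avg card_signed_perms // sum_signed_perms.
by field; rewrite gt_eqF // card_perms_gt0.
Qed.

Lemma signed_avg1 s N : (0 < N)%N -> signed_avg s N (fun=> 1) = 1.
Proof.
move=> N0; rewrite /signed_avg sumr_const divff // card_signed_perms //.
by rewrite mulf_neq0 // gt_eqF // card_perms_gt0.
Qed.

Lemma signed_avg_dsum s N : (3 <= N)%N -> signed_avg s N id = 0.
Proof.
move=> N3; rewrite signed_avgE; last by lia.
by rewrite sum_sgn_dsum // sum_dsum mulr0 addr0 mul0r.
Qed.

Lemma signed_avg_dsum_sqr s N : (5 <= N)%N ->
  signed_avg s N (fun z => z ^+ 2) = N.+2%:R / 12.
Proof.
move=> N5; rewrite signed_avgE; last by lia.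
rewrite sum_sgn_dsum_sqr // sum_dsum_sqr; last by lia.
by rewrite mulr0 addr0 mulrAC divff ?mul1r // gt_eqF // card_perms_gt0.
Qed.

Definition dsd N : R := Num.sqrt (N.+2%:R / 12).

Lemma dsd_gt0 N : 0 < dsd N.
Proof. by rewrite sqrtr_gt0 divr_gt0 ?ltr0n. Qed.

Lemma dsd_sqr N : dsd N ^+ 2 = N.+2%:R / 12.
Proof. by rewrite sqr_sqrtr // divr_ge0. Qed.

Definition signed_cdf s N x := signed_avg s N (fun z => (z / dsd N <= x)%R%:R).

Let uniform_cdf N x : R :=
  (\sum_(w : 'S_N.+1) (dsum w / dsd N <= x)%R%:R) / #|{: 'S_N.+1}|%:R.

Let signed_cdf_uniform s N x : (0 < N)%N ->
  `|signed_cdf s N x - uniform_cdf N x| <= 2 / N%:R.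
Proof.
move=> N0; rewrite /signed_cdf signed_avgE // /uniform_cdf -mulrBl.
rewrite [_ - _]addrAC subrr add0r normrM normfV [`|_%:R|]normr_nat.
rewrite ler_pdivrMr ?card_perms_gt0 // normrM normr_sign mul1r.
rewrite mulrC; apply: (@sum_sgn_dsum_le _ _ N0 (fun z => (z / dsd N <= x)%R%:R)) => z.
by case: (z / _ <= x); rewrite ?normr1 // normr0.
Qed.

Let card_pos N : 0 < #|{: 'S_N.+1}|%:R :> R := card_perms_gt0.

(** The pointwise inequality of [stein_test_upper] is averaged and [stein_bound] applied; [C]
    depends on [x] and [y] but not on [N]. *)
Let uniform_cdf_le x y : x < y -> exists C, forall N, (0 < N)%N ->
  uniform_cdf N x <= normal_cdf y + C / dsd N.
Proof.
move=> xy; have [f [f1 [C [h1 h2 h3]]]] := stein_test_upper xy.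
exists (28 * C) => N N0; rewrite /uniform_cdf ler_pdivrMr // mulrDl.
have := stein_bound N0 (dsd_gt0 N) (dsd_sqr N) h1 h2.
move=> /(le_trans (ler_norm _)) hb.
rewrite -lerBlDl mulrC [_ / _ * _]mulrC; apply: le_trans hb.
rewrite mulr_natl -sumr_const -sumrB; apply: ler_sum => w _; exact: h3.
Qed.

Let uniform_cdf_ge x y : y < x -> exists C, forall N, (0 < N)%N ->
  normal_cdf y - C / dsd N <= uniform_cdf N x.
Proof.
move=> yx; have [f [f1 [C [h1 h2 h3]]]] := stein_test_lower yx.
exists (28 * C) => N N0; rewrite /uniform_cdf ler_pdivlMr // mulrBl.
have := stein_bound N0 (dsd_gt0 N) (dsd_sqr N) h1 h2.
rewrite ler_norml => /andP[hb _].
rewrite lerBlDl -lerBlDr mulrC [_ / _ * _]mulrC -lerN2 opprB; apply: le_trans hb _.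
rewrite mulr_natl -sumr_const -sumrB; apply: ler_sum => w _; exact: h3.
Qed.

Let div_dsd_small (C e : R) : 0 < e ->
  exists N0, forall N, (N0 <= N)%N -> C / dsd N <= e.
Proof.
move=> e0; pose K := `|C| / e.
have K0 : 0 <= K by rewrite divr_ge0 // ltW.
exists (Num.bound (12 * K ^+ 2)) => N hN.
have hK : K <= dsd N.
  rewrite -ler_sqr ?nnegrE ?(ltW (dsd_gt0 N)) // dsd_sqr ler_pdivlMr // mulrC.
  have := @archi_boundP _ (12 * K ^+ 2) _.
  rewrite mulr_ge0 ?sqr_ge0 // => /(_ isT) /ltW h; apply: le_trans h _.
  by rewrite ler_nat; lia.
rewrite ler_pdivrMr ?dsd_gt0 // (le_trans (ler_norm _)) //.
by rewrite -ler_pdivrMl // mulrC.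
Qed.

Lemma signed_cdf_cvg s (x : R) :
  signed_cdf s N x @[N --> \oo] --> normal_cdf x.
Proof.
apply/cvgrPdist_le => e e0.
(* Three errors of at most [e / 4] each: continuity of the limit, the Stein bound, and the passage
   to a sign class. The points [y] and [z] are chosen before [N], since the Stein constants depend
   on them. *)
have e4 : 0 < e / 4 by rewrite divr_gt0.
have cP : normal_cdf y @[y --> x] --> normal_cdf x := @continuous_normal_cdf R x.
have h : \forall y \near x, `|normal_cdf x - normal_cdf y| <= e / 4.
  by move/cvgrPdist_le : cP; apply.
have [y [xy Py]] : exists y, x < y /\ `|normal_cdf x - normal_cdf y| <= e / 4.
  near (x^'+)%R => y; exists y; split.
    by near: y; exact: nbhs_right_gt.
  by near: y; exact: cvg_within h.
have [z [zx Pz]] : exists z, z < x /\ `|normal_cdf x - normal_cdf z| <= e / 4.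
  near (x^'-)%R => u; exists u; split.
    by near: u; exact: nbhs_left_lt.
  by near: u; exact: cvg_within h.
have [C1 hC1] := uniform_cdf_le xy; have [C2 hC2] := uniform_cdf_ge zx.
have [N1 hN1] := div_dsd_small C1 e4; have [N2 hN2] := div_dsd_small C2 e4.
near=> N.
have N0 : (0 < N)%N by near: N; exact: nbhs_infty_gt.
have a1 : (N1 <= N)%N by near: N; exact: nbhs_infty_ge.
have a2 : (N2 <= N)%N by near: N; exact: nbhs_infty_ge.
have a3 : 2 / N%:R <= e / 4.
  rewrite ler_pdivrMr ?ltr0n // mulrC -ler_pdivrMr //.
  by near: N; exact: nbhs_infty_ger.
have := hC1 _ N0; have := hC2 _ N0; have := hN1 _ a1; have := hN2 _ a2.
have := signed_cdf_uniform s x N0.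
move: Py Pz; rewrite !ler_norml => /andP[? ?] /andP[? ?] /andP[? ?] ? ? ? ?.
by apply/andP; split; lra.
Unshelve. all: by end_near. Qed.

End AverageLimit.

(** * Random variables *)

Section FiniteSupport.
Context d (T : measurableType d) (R : realType) (P : probability T R).
Context (X : {RV P >-> R}) (n : nat) (p : nat -> R).
Context (Xp : forall i, (i < n)%N -> P [set t | X t = i.+1%:R] = (p i)%:E)
  (p1 : \sum_(i < n) p i = 1).

Let D (i : nat) : set T := X @^-1` [set i.+1%:R].

Let mD i : measurable (D i).
Proof. exact: measurable_funPTI. Qed.

Let trivD : trivIset setT D.
Proof.
move=> i j _ _ [t [Di Dj]]; have : i.+1%:R = j.+1%:R :> R by rewrite -Di -Dj.
by move/eqP; rewrite eqr_nat => /eqP[].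
Qed.

Let U := \big[setU/set0]_(i < n) D i.

Let mU : measurable U. Proof. by apply: bigsetU_measurable => i _. Qed.

Let PU : P (~` U) = 0%E.
Proof.
rewrite probability_setC // measure_bigsetU //.
rewrite (eq_bigr (fun i : 'I_n => (p i)%:E)) => [|i _]; last exact: Xp.
by rewrite sumEFin p1 subee.
Qed.

(** The masses sum to 1, so the complement of [U] is null; on [U] the function [g \o X] is a finite
    combination of indicators. *)
Lemma expectation_finite_support (g : R -> R) : measurable_fun setT g ->
  'E_P[g \o X]%E = (\sum_(i < n) g i.+1%:R * p i)%:E.
Proof.
move=> mg; rewrite unlock.
pose h t : \bar R := (\sum_(i < n) (g i.+1%:R)%:E * (\1_(D i) t)%:E)%E.
have mi (i : nat) : P.-integrable setT (fun t => ((g i.+1%:R)%:E * (\1_(D i) t)%:E)%E).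
  by apply: integrableZl => //; exact: integrable_indic.
rewrite (ae_eq_integral h) //=.
- rewrite /h integral_sum //= -sumEFin; apply: eq_bigr => i _.
  rewrite integralZl //; last exact: integrable_indic.
  rewrite integral_indic // setIT EFinM; congr (_ * _)%E.
  exact: Xp.
- by apply/measurable_EFinP; apply: measurableT_comp.
- apply: emeasurable_sum => i; exact: measurable_int (mi i).
exists (~` U); split => //; first exact: measurableC.
apply: subsetC => t; rewrite /U -bigcup_mkord => -[i /= ni Dt] _.
rewrite /h (bigD1 (Ordinal ni)) //= big1 => [|j ji].
  by rewrite adde0 indicE mem_set // mule1 Dt.
rewrite indicE memNset ?mule0 // => Djt; move/eqP: ji; apply; apply: val_inj => /=.
by apply: (trivD I I); exists t.
Qed.

Lemma prob_finite_support (A : set R) : measurable A ->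
  P (X @^-1` A) = (\sum_(i < n) \1_A i.+1%:R * p i)%:E.
Proof.
move=> mA; rewrite -expectation_finite_support; last exact: measurable_indic.
rewrite unlock -[RHS]/(\int[P]_t (\1_(X @^-1` A) t)%:E)%E integral_indic ?setIT //.
exact: measurable_funPTI.
Qed.

End FiniteSupport.

(** * The law of the descent number on a sign class *)

Section SignedEulerianLaw.
Context {R : realType}.
Implicit Types (s : bool) (N : nat).

Lemma des_le N (w : 'S_N.+1) : (des w <= N)%N.
Proof.
apply: (@leq_trans #|predC1 (@ord_max N)|); last by rewrite cardC1 card_ord.
apply: subset_leq_card; apply/fintype.subsetP => i; rewrite !inE.
case/existsP=> j /andP[/eqP ji _].
by apply/eqP => im; have := ltn_ord j; rewrite ji im /= ltnn.
Qed.

(** Permutations are grouped by descent number, with [des w + 1] equal to [dsum w + (N + 2) / 2]. *)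
Lemma sum_signed_eulerian s N (g : R -> R) :
  \sum_(i < N.+1) g i.+1%:R *
    ((signed_eulerian N.+1 s i.+1)%:R / #|signed_perms N.+1 s|%:R) =
  signed_avg s N (fun z => g (z + N.+2%:R / 2)).
Proof.
rewrite /signed_avg mulr_suml.
transitivity (\sum_(i < N.+1) \sum_(w in signed_perms N.+1 s)
    (g i.+1%:R / #|signed_perms N.+1 s|%:R) * (des w == i)%:R).
  apply: eq_bigr => i _; rewrite -mulr_sumr mulrA mulrAC; congr (_ * _).
  rewrite /signed_eulerian -sum1_card natr_sum.
  rewrite [LHS]big_mkcond [RHS]big_mkcond; apply: eq_bigr => w _.
  by rewrite !inE eqSS; case: (_ == s) => //=; case: eqP.
rewrite exchange_big; apply: eq_bigr => w _.
have dw := des_le w; rewrite -ltnS in dw.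
rewrite (bigD1 (Ordinal dw)) //= eqxx mulr1 big1 ?addr0 => [|i iw].
  congr (g _ / _); rewrite -addn1 natrD des_dsum.
  by rewrite -[N.+2]addn2 natrD; field.
case: eqP => [e|_]; last by rewrite mulr0.
by move/eqP: iw; case; apply: val_inj.
Qed.

Lemma signed_avgD s N (g h : R -> R) :
  signed_avg s N (fun z => g z + h z) = signed_avg s N g + signed_avg s N h.
Proof. by rewrite /signed_avg big_split mulrDl. Qed.

Lemma signed_avg_cst s N (c : R) : (0 < N)%N -> signed_avg s N (fun=> c) = c.
Proof.
move=> N0; rewrite -[RHS]mulr1 -(@signed_avg1 R s N N0) /signed_avg mulrA mulr_sumr.
by under [in RHS]eq_bigr do rewrite mulr1.
Qed.

Section Law.
Context d (T : measurableType d) (P : probability T R) (X : {RV P >-> R}).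
Context (s : bool) (N : nat) (N_gt0 : (0 < N)%N).
Context (X_law : forall k : nat, (1 <= k <= N.+1)%N ->
  P [set t | X t = k%:R] =
  ((signed_eulerian N.+1 s k)%:R / #|signed_perms N.+1 s|%:R)%:E).

Let p i : R := (signed_eulerian N.+1 s i.+1)%:R / #|signed_perms N.+1 s|%:R.

Let Xp i : (i < N.+1)%N -> P [set t | X t = i.+1%:R] = (p i)%:E.
Proof. by move=> iN; exact: X_law. Qed.

Let p1 : \sum_(i < N.+1) p i = 1.
Proof.
rewrite -[RHS](signed_avg1 s N_gt0) -(sum_signed_eulerian s N (fun=> 1)).
by apply: eq_bigr => i _; rewrite mul1r.
Qed.

Lemma expectation_signed (g : R -> R) : measurable_fun setT g ->
  'E_P[g \o X]%E = (signed_avg s N (fun z => g (z + N.+2%:R / 2)))%:E.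
Proof.
by move=> mg; rewrite (expectation_finite_support Xp p1 mg) sum_signed_eulerian.
Qed.

Lemma mean_signed : (3 <= N)%N -> 'E_P[X]%E = (N.+2%:R / 2)%:E.
Proof.
move=> N3; rewrite -[LHS]/('E_P[id \o X]%E).
rewrite expectation_signed; last exact: measurable_id.
by rewrite signed_avgD signed_avg_dsum // signed_avg_cst // add0r.
Qed.

Lemma variance_signed : (5 <= N)%N -> 'V_P[X]%E = (N.+2%:R / 12)%:E.
Proof.
move=> N5; rewrite /variance unlock mean_signed; last by lia.
rewrite [fine _]/=; set m := N.+2%:R / 2.
pose g (y : R) := (y - m) ^+ 2; transitivity ('E_P[g \o X]%E).
  by congr expectation; apply/funext => t; rewrite /= expr2.
rewrite expectation_signed; last by apply: measurable_funX; apply: measurable_funB.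
congr (_%:E); rewrite -(signed_avg_dsum_sqr s N5); congr signed_avg.
by apply/funext => z; rewrite /g addrK.
Qed.

(** For these [N] the mean and standard deviation are exactly [N.+2%:R / 2] and [dsd N], so
    standardizing gives [dsum w / dsd N]. *)
Lemma cdf_standardize_signed x : (5 <= N)%N ->
  cdf (standardize X) x = (signed_cdf s N x)%:E.
Proof.
move=> N5; set m : R := N.+2%:R / 2.
have -> : cdf (standardize X) x = P (X @^-1` `]-oo, m + x * dsd N]).
  rewrite /cdf /distribution /pushforward; congr (P _).
  apply/funext => t; apply/propext; rewrite /= /standardize_fun !in_itv /=.
  rewrite mean_signed; last by lia.
  rewrite variance_signed // [fine _]/= [fine _]/= -/(dsd N) -/m.
  by rewrite ler_pdivrMr ?dsd_gt0 // lerBlDl.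
rewrite (prob_finite_support Xp p1) // sum_signed_eulerian; congr (_%:E).
rewrite /signed_cdf; congr signed_avg; apply/funext => z.
rewrite indicE mem_setE in_itv /= ler_pdivrMr ?dsd_gt0 //.
by rewrite -/m addrC lerD2l.
Qed.

End Law.

End SignedEulerianLaw.

Theorem theorem1p2 (R : realType) (s : bool) (d : nat -> measure_display)
    (T : forall n, measurableType (d n)) (P : forall n, probability (T n) R)
    (W : forall n, {RV (P n) >-> R})
    (hW : forall n k : nat, (0 < #|signed_perms n s|)%N ->
       (1 <= k <= n)%N ->
       P n [set x | W n x = k%:R] =
       ((signed_eulerian n s k)%:R / #|signed_perms n s|%:R)%:E) :
  [/\ cvg_in_distribution (fun n => standardize (W n)) (normal_prob 0 1),
      forall n : nat, (4 <= n)%N -> 'E_(P n)[(W n)]%E = (n.+1%:R / 2)%:E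
    & forall n : nat, (6 <= n)%N -> 'V_(P n)[(W n)]%E = (n.+1%:R / 12)%:E].
Proof.
have law N : (0 < N)%N -> forall k : nat, (1 <= k <= N.+1)%N ->
    P N.+1 [set x | W N.+1 x = k%:R] =
    ((signed_eulerian N.+1 s k)%:R / #|signed_perms N.+1 s|%:R)%:E.
  move=> N0 k hk; apply: hW => //.
  (* Each sign class is half of the group once n is at least 2, hence nonempty. *)
  by rewrite -(ltr0n R) card_signed_perms // mulr_gt0 ?card_perms_gt0.
split=> [x _|[//|N] N3|[//|N] N5].
- rewrite -cvg_shiftS /= normal_prob_NyE.
  (* The exact formula starts at [N = 5], which is enough for a limit. *)
  have cdfE : \forall N \near \oo,
      cdf (standardize (W N.+1)) x = (signed_cdf s N x)%:E.
    near=> N; have N5 : (5 <= N)%N by near: N; exact: nbhs_infty_ge.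
    by apply: cdf_standardize_signed => //; [lia | apply: law; lia].
  apply: cvg_EFin; first by apply: filterS cdfE => N ->.
  apply: cvg_trans (@signed_cdf_cvg R s x); apply: near_eq_cvg.
  by apply: filterS cdfE => N /= ->.
- by apply: mean_signed (law N _) _; lia.
- by apply: variance_signed (law N _) _; lia.
Unshelve. all: by end_near. Qed.
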